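(* Let $0<\rho<1$, let $\psi_\rho$ be a scaled zonal kernel belonging to a family satisfying the kernel assumption stated in the context, and let $\Psi_\rho=\Psi_\rho^{\mathrm{div}}+\Psi_\rho^{\mathrm{curl}}$ be the associated matrix-valued kernel. Then the integral operator on $\mathbf L_2(\mathbb S^2)$ $$(\mathcal C_{\Psi_\rho}\mathbf f)(x)=\int_{\mathbb S^2}\bigl(\Psi_\rho^{\mathrm{div}}(x,y)+\Psi_\rho^{\mathrm{curl}}(x,y)\bigr)\mathbf f(y)\,d\mu(y)$$ is a simple Fourier–Legendre multiplier.
   Context: $\mathbb S^2$ is the unit sphere in $\mathbb R^3$ with (unnormalized) surface measure $\mu$. $\mathbf L_2(\mathbb S^2)$ is the space of square-integrable tangential vector fields $\mathbf f:\mathbb S^2\to\mathbb R^3$ ($x^\top\mathbf f(x)=0$), with inner product $\langle\mathbf f,\mathbf g\rangle=\int\mathbf f^\top\mathbf g\,d\mu$. $\{Y_{\ell,k}\}_{k=1}^{2\ell+1}$ is a real orthonormal basis of the spherical harmonics of degree $\ell$; $\nabla_*f(x)=(\mathbf I-xx^\top)\nabla f(x)$, $\mathbf L_*f(x)=x\times\nabla f(x)$; for $\ell\ge1$, $\mathbf y_{\ell,k}=\mathbf L_*Y_{\ell,k}/\sqrt{\ell(\ell+1)}$, $\mathbf z_{\ell,k}=\nabla_*Y_{\ell,k}/\sqrt{\ell(\ell+1)}$. Together the $\mathbf y_{\ell,k},\mathbf z_{\ell,k}$ form an orthonormal basis of $\mathbf L_2(\mathbb S^2)$. Fourier–Legendre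 multiplier: a linear operator $\mathcal T$ on $\mathbf L_2(\mathbb S^2)$ for which, for all $\ell\ge1$ and $1\le k\le2\ell+1$, there are real numbers $a_{\ell,k},b_{\ell,k}$ with $\mathcal T\mathbf y_{\ell,k}=a_{\ell,k}\mathbf y_{\ell,k}$ and $\mathcal T\mathbf z_{\ell,k}=b_{\ell,k}\mathbf z_{\ell,k}$. It is simple if $a_{\ell,k}$ and $b_{\ell,k}$ do not depend on $k$. Scaled zonal kernel: for a fixed $\phi\in C[0,\infty)$ and $\rho\in(0,1)$, $\psi_\rho(x\cdot y)=C_{\psi,\rho}\,\phi(\rho^{-1}\|x-y\|)$ for $x,y\in\mathbb S^2$, where the constant $C_{\psi,\rho}$ is such that $\int_{\mathbb S^2}\psi_\rho(x\cdot y)\,d\mu(x)=1$; $\psi_\rho$ is regarded as a function on $[-1,1]$. Its Fourier–Legendre coefficients are $\widehat\psi_\rho(\ell)=2\pi\int_{-1}^1\psi_\rho(t)P_\ell(t)\,dt$ ($P_\ell$ Legendre polynomial, $P_\ell(1)=1$). Kernel assumption: there exist $0<\rho_0<1$, $m\ge0$, $c_1,c_2>0$ such that $|1-\widehat\psi_\rho(\ell)|\le c_1(\ell\rho)^m$ for $0<\rho<\rho_0$ and $0\le\ell\le\ell_\rho:=\lfloor\rho^{-1}-1\rfloor$, and $|\widehat\psi_\rho(\ell)|\le c_2$ for $\ell>\ell_\rho$. Matrix kernels: $\kappa(t)=\frac1{4\pi(1-t^2)}\int_{-1}^t(1-4\pi\psi_\rho(s))\,ds$ on $(-1,1)$, extended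 continuously to $[-1,1]$. With $t=x\cdot y$, $\Psi^{\mathrm{div}}_\rho(x,y)=-\kappa'(t)(x\times y)(x\times y)^\top+\kappa(t)(t\mathbf I-yx^\top)$ and $\Psi^{\mathrm{curl}}_\rho(x,y)=\kappa'(t)(y-tx)(x-ty)^\top+\kappa(t)(\mathbf I-xx^\top)(\mathbf I-yy^\top)$, with values at $x=\pm y$ given by continuous extension. *)

(* Defs.v *)
From HB Require Import structures.
From mathcomp Require Import all_boot all_order all_algebra.
From mathcomp Require Import all_classical all_reals all_analysis.
From mathcomp Require Import measurable_realfun.
(* Only imported in part: its notations clash with those of MathComp-Analysis. *)
From mathcomp Require mpoly.
Import (canonicals, coercions) mpoly.

Set Implicit Arguments.
Unset Strict Implicit.
Unset Printing Implicit Defensive.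
Import Order.TTheory GRing.Theory Num.Theory.
Import numFieldNormedType.Exports.

Local Open Scope classical_set_scope.
Local Open Scope ring_scope.

(* Column vectors carry the product sigma-algebra, generated by the coordinates
   as for n.-tuple in the library; over the reals it is the Borel one. *)
Section measurable_cvec.
Context {d} {T : sigmaRingType d} {n : nat}.

Let coord (i : 'I_n) (x : 'cV[T]_n) : T := x i 0.

Let cvec_set0 : g_sigma_preimage coord set0.
Proof. exact: sigma_algebra0. Qed.

Let cvec_setC A : g_sigma_preimage coord A -> g_sigma_preimage coord (~` A).
Proof. exact: sigma_algebraC. Qed.

Let cvec_bigcup (F : _^nat) : (forall i, g_sigma_preimage coord (F i)) ->
  g_sigma_preimage coord (\bigcup_i (F i)).
Proof. exact: sigma_algebra_bigcup. Qed.

HB.instance Definition _ := @isMeasurable.Build (measure_tuple_display d)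
  'cV[T]_n (g_sigma_preimage coord) cvec_set0 cvec_setC cvec_bigcup.
End measurable_cvec.

Lemma measurable_fun_cvec d d' (T1 : measurableType d) (T2 : sigmaRingType d')
    (n : nat) (f : T1 -> 'cV[T2]_n) :
  (forall i, measurable_fun [set: T1] (fun x => f x i 0)) ->
  measurable_fun [set: T1] f.
Proof.
move=> mf _; set G := \big[setU/set0]_(i < n) preimage_set_system setT
  (fun x : 'cV[T2]_n => x i 0) measurable.
suff GP : G `<=` [set B | measurable (f @^-1` B)].
  move=> B mB; rewrite setTI.
  suff /(_ _ mB) : <<s G >> `<=` [set B | measurable (f @^-1` B)] by [].
  apply: smallest_sub => //; split => /=.
  - by rewrite preimage_set0.
  - by move=> A /= mA; rewrite setTD preimage_setC; exact: measurableC.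
  - by move=> F mF; rewrite preimage_bigcup; exact: bigcupT_measurable.
move=> B; rewrite /G -bigcup_seq => -[i _ [A mA <-]] /=.
by rewrite setTI; have := mf i measurableT A mA; rewrite setTI.
Qed.

Section sphere.
Context {R : realType}.
Implicit Types u v x : 'cV[R]_3.

Definition dot u v : R := (u^T *m v) 0 0.

(* Euclidean norm; the norm of the library on matrices is the sup norm. *)
Definition enorm u : R := Num.sqrt (dot u u).

(* Indices are in 'I_3, hence taken modulo 3. *)
Definition cross u v : 'cV[R]_3 :=
  \col_(i < 3) (u (i + 1) 0 * v (i + 2) 0 - u (i + 2) 0 * v (i + 1) 0).

Definition S2 : set 'cV[R]_3 := [set x | enorm x = 1].

End sphere.

(* The surface measure on S2, as a measure on R^3 carried by S2: the image of
   dz dtheta under the parametrization by height z and longitude theta, whose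
   area element |d_z sigma x d_theta sigma| is equal to 1. *)
Section surface_measure.
Variable R : realType.

Definition sphere_param (p : R * R) : 'cV[R]_3 :=
  \col_(i < 3) nth 0 [:: Num.sqrt (1 - p.1 ^+ 2) * cos p.2;
                         Num.sqrt (1 - p.1 ^+ 2) * sin p.2;
                         p.1] i.

Lemma measurable_sphere_param : measurable_fun setT sphere_param.
Proof.
have msqrt : measurable_fun setT (fun p : R * R => Num.sqrt (1 - p.1 ^+ 2)).
  apply: measurableT_comp.
    exact: (continuous_measurable_fun (@sqrt_continuous R)).
  by apply: measurable_funB => //; exact: measurable_funX.
apply: measurable_fun_cvec => i; under eq_fun do rewrite mxE.
case: i => -[|[|[|//]]] _ /=; last exact: measurable_fst.
- apply: measurable_funM => //; apply: measurableT_comp => //.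
  exact: (continuous_measurable_fun (@continuous_cos R)).
- apply: measurable_funM => //; apply: measurableT_comp => //.
  exact: (continuous_measurable_fun (@continuous_sin R)).
Qed.

Definition param_domain : set (R * R) := `[-1, 1] `*` `[0, 2 * pi].

Lemma measurable_param_domain : measurable param_domain.
Proof. exact: measurableX. Qed.

Definition surface_measure : set 'cV[R]_3 -> \bar R :=
  pushforward (mrestr (lebesgue_measure \x lebesgue_measure)%E
                      measurable_param_domain) sphere_param.

Let mu0 : surface_measure set0 = 0%E.
Proof. by rewrite /surface_measure /pushforward preimage_set0 measure0. Qed.

Let mu_ge0 A : (0 <= surface_measure A)%E.
Proof. by rewrite /surface_measure /pushforward measure_ge0. Qed.

Let mu_sigma_additive : semi_sigma_additive surface_measure.
Proof.
pose nu := mrestr (lebesgue_measure \x lebesgue_measure)%E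
  measurable_param_domain.
exact: (@measure_semi_sigma_additive _ _ _
  (@measure_function_pushforward__canonical__measure_function_Measure
    _ _ _ _ R nu _ measurable_sphere_param)).
Qed.

HB.instance Definition _ := isMeasure.Build _ _ _ surface_measure
  mu0 mu_ge0 mu_sigma_additive.

End surface_measure.

Arguments surface_measure : clear implicits.

Section vector_fields.
Context {R : realType}.
Local Notation mu := (surface_measure R).
Implicit Types (f : 'cV[R]_3 -> R) (F G : 'cV[R]_3 -> 'cV[R]_3).

Definition grad f (x : 'cV[R]_3) : 'cV[R]_3 :=
  \col_(i < 3) 'D_(delta_mx i 0) f x.

Definition surface_grad f (x : 'cV[R]_3) : 'cV[R]_3 :=
  (1%:M - x *m x^T) *m grad f x.

Definition surface_curl f (x : 'cV[R]_3) : 'cV[R]_3 := cross x (grad f x).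

(* Elements of the space of square-integrable tangential fields are handled
   through representatives F : R^3 -> R^3, of which only the values on S2
   matter, up to equality almost everywhere. *)
Definition L2_tangential F : Prop :=
  [/\ measurable_fun S2 F,
      {ae mu, forall x, S2 x -> dot x (F x) = 0} &
      (\int[mu]_(x in S2) ((enorm (F x)) ^+ 2)%:E < +oo)%E].

Definition linear_operator_L2
    (T : ('cV[R]_3 -> 'cV[R]_3) -> ('cV[R]_3 -> 'cV[R]_3)) : Prop :=
  [/\ forall F, L2_tangential F -> L2_tangential (T F),
      forall F G, L2_tangential F -> L2_tangential G ->
        ae_eq mu S2 F G -> ae_eq mu S2 (T F) (T G) &
      forall (a : R) F G, L2_tangential F -> L2_tangential G ->
        ae_eq mu S2 (T (a \*: F \+ G)) (a \*: T F \+ T G)].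

End vector_fields.

Section spherical_harmonics.
Context {R : realType}.
Local Notation mu := (surface_measure R).

Definition mpoly_laplacian (p : mpoly.mpoly 3 R) : mpoly.mpoly 3 R :=
  \sum_(i < 3) mpoly.mderiv i (mpoly.mderiv i p).

(* p \is l.-homog, written without the notations of mpoly. *)
Definition homogeneous (l : nat) (p : mpoly.mpoly 3 R) : bool :=
  p \is mpoly.ishomog1 l [the mpoly.Measure.type 3 of @mpoly.mdeg 3].

(* A spherical harmonic of degree l, i.e. the restriction to S2 of a homogeneous
   harmonic polynomial of degree l, is identified with that polynomial, which
   extends it to R^3; surface_grad and surface_curl do not depend on the
   extension. *)
Definition spherical_harmonic (l : nat) (f : 'cV[R]_3 -> R) : Prop :=
  exists p : mpoly.mpoly 3 R,
    [/\ homogeneous l p,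
        mpoly_laplacian p = 0 &
        f = fun x => mpoly.meval (fun i => x i 0) p].

Definition harmonic_orthonormal_basis (l : nat)
    (Y : 'I_((2 * l).+1) -> 'cV[R]_3 -> R) : Prop :=
  [/\ forall k, spherical_harmonic l (Y k),
      forall j k, \int[mu]_(x in S2) (Y j x * Y k x) = (j == k)%:R &
      forall f, spherical_harmonic l f ->
        exists c : 'I_((2 * l).+1) -> R,
          forall x, S2 x -> f x = \sum_k c k * Y k x].

Variable Y : forall l : nat, 'I_((2 * l).+1) -> 'cV[R]_3 -> R.

Definition y_field (l : nat) (k : 'I_((2 * l).+1)) (x : 'cV[R]_3) : 'cV[R]_3 :=
  (Num.sqrt (l * l.+1)%N%:R)^-1 *: surface_curl (Y k) x.

Definition z_field (l : nat) (k : 'I_((2 * l).+1)) (x : 'cV[R]_3) : 'cV[R]_3 :=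
  (Num.sqrt (l * l.+1)%N%:R)^-1 *: surface_grad (Y k) x.

Definition multiplier_with_symbol
    (T : ('cV[R]_3 -> 'cV[R]_3) -> ('cV[R]_3 -> 'cV[R]_3))
    (a b : forall l : nat, 'I_((2 * l).+1) -> R) : Prop :=
  linear_operator_L2 T /\
  forall (l : nat) (k : 'I_((2 * l).+1)), (1 <= l)%N ->
    ae_eq mu S2 (T (y_field k)) (a l k \*: y_field k) /\
    ae_eq mu S2 (T (z_field k)) (b l k \*: z_field k).

Definition fourier_legendre_multiplier T : Prop :=
  exists a b, multiplier_with_symbol T a b.

Definition simple_fourier_legendre_multiplier T : Prop :=
  exists a b, multiplier_with_symbol T a b /\
    forall (l : nat) (j k : 'I_((2 * l).+1)), (1 <= l)%N ->
      a l j = a l k /\ b l j = b l k.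

End spherical_harmonics.

Section kernels.
Context {R : realType}.
Local Notation mu := (surface_measure R).

(* Rodrigues' formula. *)
Definition legendre (l : nat) : {poly R} :=
  (2 ^+ l * l`!%:R)^-1 *: (('X ^+ 2 - 1) ^+ l)^`(l).

(* psi is the kernel seen as a function on [-1, 1]; its values elsewhere are
   never used. *)
Definition scaled_zonal_kernel (phi : R -> R) (rho : R) (psi : R -> R) : Prop :=
  exists C : R,
    (forall x y, S2 x -> S2 y ->
       psi (dot x y) = C * phi (rho^-1 * enorm (x - y))) /\
    (forall y, S2 y -> \int[mu]_(x in S2) psi (dot x y) = 1).

Definition fourier_legendre_coef (psi : R -> R) (l : nat) : R :=
  2 * pi * \int[lebesgue_measure]_(t in `[-1, 1]) (psi t * (legendre l).[t]).

Definition kernel_assumption (psi : R -> R -> R) : Prop :=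
  exists rho0 m c1 c2 : R,
    [/\ 0 < rho0 < 1, 0 <= m, 0 < c1, 0 < c2 &
      forall (rho : R) (l : nat), 0 < rho < rho0 ->
        let l_rho := Num.floor (rho^-1 - 1) in
        (l%:Z <= l_rho ->
           `|1 - fourier_legendre_coef (psi rho) l|
             <= c1 * (l%:R * rho) `^ m) /\
        (l_rho < l%:Z -> `|fourier_legendre_coef (psi rho) l| <= c2)].

Definition continuous_extension (T : topologicalType) (U : ptopologicalType)
    (D : set T) (f : T -> U) (x : T) : U :=
  if x \in D then f x else lim (f y @[y --> within D (nbhs x)]).

Definition kappa (psi : R -> R) : R -> R :=
  @continuous_extension R R `]-1, 1[ (fun t =>
    (4 * pi * (1 - t ^+ 2))^-1 *
    \int[lebesgue_measure]_(s in `[-1, t]) (1 - 4 * pi * psi s)).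

Definition generic_pairs : set ('cV[R]_3 * 'cV[R]_3) :=
  [set p | [/\ S2 p.1, S2 p.2, p.1 <> p.2 & p.1 <> - p.2]].

Definition Psi_div (psi : R -> R) (x y : 'cV[R]_3) : 'M[R]_3 :=
  continuous_extension generic_pairs (fun p =>
    let: (x, y) := p in let t := dot x y in
    (- derive1 (kappa psi) t) *: (cross x y *m (cross x y)^T)
    + kappa psi t *: (t%:M - y *m x^T)) (x, y).

Definition Psi_curl (psi : R -> R) (x y : 'cV[R]_3) : 'M[R]_3 :=
  continuous_extension generic_pairs (fun p =>
    let: (x, y) := p in let t := dot x y in
    derive1 (kappa psi) t *: ((y - t *: x) *m (x - t *: y)^T)
    + kappa psi t *: ((1%:M - x *m x^T) *m (1%:M - y *m y^T))) (x, y).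

Definition Psi (psi : R -> R) (x y : 'cV[R]_3) : 'M[R]_3 :=
  Psi_div psi x y + Psi_curl psi x y.

Definition integral_operator (K : 'cV[R]_3 -> 'cV[R]_3 -> 'M[R]_3)
    (F : 'cV[R]_3 -> 'cV[R]_3) (x : 'cV[R]_3) : 'cV[R]_3 :=
  \col_(i < 3) \int[mu]_(y in S2) (K x y *m F y) i 0.

(* The integral above is the default value 0 where the integrand is not
   integrable. *)
Definition integral_operator_defined
    (K : 'cV[R]_3 -> 'cV[R]_3 -> 'M[R]_3) : Prop :=
  forall F, L2_tangential F -> forall x, S2 x -> forall i : 'I_3,
    mu.-integrable S2 (fun y => ((K x y *m F y) i 0)%:E).

End kernels.

(* Main.v *)
(* The kernel kappa depends linearly on h = 1 - 4 pi psi, and the entries of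
   Psi = Psi_div + Psi_curl at (x, y), with t = x.y, are bounded by
   2 (1 - t^2) |kappa'(t)| + 6 |kappa(t)|. Approximating h uniformly by
   polynomials (Weierstrass) and dividing their primitives by 1 - t^2 gives
   polynomials q for which q - kappa and (1 - t^2) (q' - kappa') are uniformly
   small. The operator is therefore a limit of operators with polynomial kernels,
   and proportionality to y_{l,k} and z_{l,k}, with a factor independent of k,
   survives the limit.

   For polynomial kernels everything reduces to the integration by parts rule
   int_{S2} y_i f = (int_{S2} d_i f) / (deg f + 2), for homogeneous f, which
   is checked on monomials. With Euler's identity it yields the Funk-Hecke
   formula int (x.y)^N p(y) = c(N, l) p(x), for p harmonic of degree l, by
   induction on l, and one more application gives the integrals of
   y_i (x.y)^N p(y). For f tangential at y,
   Psi_div f = cross x (W (cross f y)) and Psi_curl f = (1 - x x^T) W(f),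
   where W(g) = kappa'(t) (x.g) y + kappa(t) g. The integral of W(g) over y is 0
   for g = L_* p, and a x + b grad p(x) for g = nabla_* p. *)

Require Import Defs.
From HB Require Import structures.
From mathcomp Require Import all_boot all_order all_algebra.
From mathcomp Require Import all_classical all_reals all_analysis.
From mathcomp Require Import measurable_realfun.
From mathcomp Require Import ring lra.
From mathcomp Require mpoly.
Import (canonicals, coercions) mpoly.
Set Implicit Arguments.
Unset Strict Implicit.
Unset Printing Implicit Defensive.
Import Order.TTheory GRing.Theory Num.Theory.
Import numFieldNormedType.Exports.
Local Open Scope classical_set_scope.
Local Open Scope ring_scope.

(** * Polynomial approximation *)

(** As phi is merely continuous, kappa' may be unbounded near the ends of []-1, 1[], and uniform
    approximation of kappa together with kappa' is out of reach. The way out is that kappa' always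
    multiplies products of vectors of squared length 1 - t^2, namely x cross y and the projections y
    - t x and x - t y, so that only (1 - t^2) kappa' has to be approximated. Dividing primitives of
    polynomials by 1 - t^2 fits this weight, and it is possible because the normalization of psi
    makes the integral of h over [-1, 1] vanish.

    The field W is a gradient in x: W(g) = grad_x (kappa(x.y) (x.g)). Its integral over y is
    therefore the gradient of the scalar function int kappa(x.y) (x.g(y)). For g = L_* p this
    function is zero, because x.g is the derivative of p along the rotation about x, which preserves
    x.y. For g = nabla_* p it is, by rotation invariance, a function of |x| times p(x), which
    explains the form a x + b grad p(x); the term a x is then killed by the cross product with x and
    by the tangential projection. *)

Section weierstrass.
Context {R : realType}.
Implicit Types (f : R -> R) (g G : nat -> R).

(* bern_op n g is the Bernstein polynomial \sum_k 'C(n, k) g(k) X^k (1 - X)^(n-k). *)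
Fixpoint bern_op (n : nat) g : {poly R} :=
  if n is m.+1 then (1 - 'X) * bern_op m g + 'X * bern_op m (fun k => g k.+1)
  else (g 0%N)%:P.

Lemma bern_opS n g x :
  (bern_op n.+1 g).[x] =
  (1 - x) * (bern_op n g).[x] + x * (bern_op n (fun k => g k.+1)).[x].
Proof. by rewrite /= !hornerE. Qed.

Lemma bern_op_le n g G x : 0 <= x <= 1 ->
  (forall k, (k <= n)%N -> `|g k| <= G k) ->
  `|(bern_op n g).[x]| <= (bern_op n G).[x].
Proof.
move=> /andP[x0 x1]; elim: n g G => [|n IHn] g G gG.
  by rewrite /= !hornerE; exact: gG.
rewrite !bern_opS (le_trans (ler_normD _ _))// !normrM.
rewrite (ger0_norm x0) ger0_norm ?subr_ge0// lerD// ler_wpM2l ?subr_ge0//.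
  by apply: IHn => k kn; apply: gG; rewrite (leq_trans kn).
by apply: IHn => k kn; apply: gG.
Qed.

Lemma bern_opB n g c x :
  (bern_op n (fun k => g k - c)).[x] = (bern_op n g).[x] - c.
Proof.
elim: n g => [|n IHn] g; first by rewrite /= !hornerE.
by rewrite !bern_opS IHn (IHn (fun k => g k.+1)); ring.
Qed.

(** Mean and variance of the binomial law with parameters n and x. The centre [c] is free for the
    sake of the induction: shifting k by one turns it into c - 1. *)
Lemma bern_op_quadratic n (a b c x : R) :
  (bern_op n (fun k => a + b * (k%:R - c) ^+ 2)).[x] =
  a + b * ((n%:R * x - c) ^+ 2 + n%:R * x * (1 - x)).
Proof.
elim: n c => [|n IHn] c; first by rewrite /= !hornerE.
rewrite bern_opS IHn.
have -> : (fun k => a + b * (k.+1%:R - c) ^+ 2) =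
          (fun k : nat => a + b * (k%:R - (c - 1)) ^+ 2).
  by apply/funext => k; rewrite -natr1; congr (_ + _ * _ ^+ 2); ring.
by rewrite IHn -natr1; ring.
Qed.

Lemma segment_unif_continuous f (a b e : R) : 0 < e -> continuous f ->
  exists2 d : R, 0 < d &
    forall x y, a <= x <= b -> `|x - y| < d -> `|f x - f y| <= e.
Proof.
move=> e0 cf.
have /compact_near_coveringP/(_ R 0^'+
  (fun d x => forall y, `|x - y| < d -> `|f x - f y| <= e)) := @segment_compact _ a b.
case => [x xab|d /= d0 Hd].
  have /cvgrPdist_lt/(_ (e / 2)) := cf x.
  rewrite divr_gt0// => /(_ isT)/nbhs_ballP[d /= d0 Hd].
  exists (ball x (d / 2), [set r : R | r < d / 2]) => /=.
    split; first by apply: nbhsx_ballx; rewrite divr_gt0.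
    by apply: nbhs_right_lt; rewrite divr_gt0.
  move=> [y r]/= [xy rd] z yz.
  have fy : `|f x - f y| < e / 2.
    by apply: Hd; rewrite /ball/= (lt_trans xy)// ltr_pdivrMr// ltr_pMr// ltr1n.
  have fz : `|f x - f z| < e / 2.
    apply: Hd; rewrite /ball/= -(subrK y x) -addrA (le_lt_trans (ler_normD _ _))//.
    by rewrite (splitr d) ltrD// (lt_trans yz).
  rewrite -(subrK (f x) (f y)) -addrA (le_trans (ler_normD _ _))//.
  by rewrite (splitr e) distrC lerD// ltW.
exists (d / 2); first by rewrite divr_gt0.
move=> x y xab xy; apply: (Hd (d / 2)) => //=.
- by rewrite sub0r normrN gtr0_norm ?divr_gt0// ltr_pdivrMr// ltr_pMr// ltr1n.
- by rewrite divr_gt0.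
Qed.

Lemma segment_bounded f (a b : R) : a <= b -> continuous f ->
  exists M : R, forall x, a <= x <= b -> `|f x| <= M.
Proof.
move=> ab cf.
have [|c _ H] := @EVT_max R (fun x => `|f x|) _ _ ab.
  by apply: continuous_subspaceT => x; apply: continuous_comp;
    [exact: cf|exact: norm_continuous].
by exists `|f c| => x xab; apply: H; rewrite in_itv/=.
Qed.

Lemma weierstrass01 f (e : R) : 0 < e -> continuous f ->
  exists p : {poly R}, forall x, 0 <= x <= 1 -> `|f x - p.[x]| <= e.
Proof.
move=> e0 cf.
have e20 : 0 < e / 2 by rewrite divr_gt0.
have [d d0 Hd] := segment_unif_continuous 0 1 e20 cf.
have [M HM] := segment_bounded ler01 cf.
have M0 : 0 <= M by rewrite (le_trans _ (HM 0 _))// lexx ler01.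
(* Chebyshev's argument: |f u - f x| <= e/2 + K (u - x)^2 for all u in [0, 1], by uniform continuity
   when |u - x| < d and because 2 M = K d^2 otherwise. The Bernstein operator turns the right-hand
   side into e/2 + K x (1 - x) / (n + 1), which the choice of [n] makes at most e. *)
set K := 2 * M / d ^+ 2.
have K0 : 0 <= K by apply: divr_ge0; [exact: mulr_ge0|exact: sqr_ge0].
have [n Hn] : exists n, 2 * K / e <= n.+1%:R.
  exists (Num.truncn (2 * K / e)).
  by rewrite ltW// truncnS_gt.
exists (bern_op n.+1 (fun k => f (k%:R / n.+1%:R))) => x /[dup] x01 /andP[x0 x1].
rewrite distrC -bern_opB.
have N0 : 0 < n.+1%:R :> R by rewrite ltr0n.
apply: (@le_trans _ _ (bern_op n.+1
   (fun k => e / 2 + K / n.+1%:R ^+ 2 * (k%:R - n.+1%:R * x) ^+ 2)).[x]).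
  apply: bern_op_le => // k kn.
  have k01 : 0 <= (k%:R / n.+1%:R : R) <= 1.
    by rewrite divr_ge0//= ler_pdivrMr// mul1r ler_nat.
  have -> : K / n.+1%:R ^+ 2 * (k%:R - n.+1%:R * x) ^+ 2 =
            K * (k%:R / n.+1%:R - x) ^+ 2.
    by rewrite -mulrA; congr (_ * _); field; rewrite lt0r_neq0.
  have [kd|dk] := ltP `|k%:R / n.+1%:R - x| d.
    by rewrite (le_trans (Hd _ _ k01 kd))// lerDl mulr_ge0// sqr_ge0.
  rewrite (le_trans (ler_normB _ _))// (@le_trans _ _ (2 * M))//.
    by rewrite mulr2n mulrDl mul1r lerD// HM.
  rewrite (@le_trans _ _ (K * (k%:R / n.+1%:R - x) ^+ 2))//; last first.
    by rewrite lerDr ltW.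
  rewrite /K mulrAC ler_pdivlMr ?exprn_gt0//.
  rewrite ler_wpM2l ?mulr_ge0// -[leRHS]ger0_norm ?sqr_ge0// normrX.
  by rewrite lerXn2r ?nnegrE// ltW.
rewrite bern_op_quadratic subrr expr0n/= add0r.
have -> : K / n.+1%:R ^+ 2 * (n.+1%:R * x * (1 - x)) = K * (x * (1 - x)) / n.+1%:R.
  by field; rewrite lt0r_neq0.
rewrite [leRHS](splitr e) lerD2l ler_pdivrMr//.
rewrite ler_pdivrMr// in Hn.
have xx : x * (1 - x) <= 1 by nra.
have : K * (x * (1 - x)) <= K by rewrite ler_piMr.
nra.
Qed.

Lemma weierstrass f (a b e : R) : a < b -> 0 < e -> continuous f ->
  exists p : {poly R}, forall x, a <= x <= b -> `|f x - p.[x]| <= e.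
Proof.
move=> ab e0 cf; have ba0 : 0 < b - a by rewrite subr_gt0.
have [|p Hp] := @weierstrass01 (fun t => f (a + t * (b - a))) e e0.
  move=> t; apply: continuous_comp; last exact: cf.
  by apply: cvgD; [exact: cvg_cst|apply: cvgM; [exact: cvg_id|exact: cvg_cst]].
exists (p \Po ((b - a)^-1 *: ('X - a%:P))) => x /andP[ax xb].
rewrite horner_comp !hornerE.
have := Hp ((b - a)^-1 * (x - a)); rewrite mulrAC mulVf ?lt0r_neq0// mul1r subrKC.
apply; rewrite mulr_ge0 ?invr_ge0 ?(ltW ba0) ?subr_ge0//=.
by rewrite mulrC ler_pdivrMr// mul1r lerB.
Qed.

End weierstrass.

(** * Approximation under the weight 1 - t^2 *)

Section weighted_approximation.
Context {R : realType}.
Implicit Types (f g h : R -> R).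

Lemma poly_antiderivative (p : {poly R}) : exists q : {poly R}, q^`() = p.
Proof.
exists (\poly_(i < (size p).+1) (p`_i.-1 / i%:R)).
apply/polyP => i; rewrite coef_deriv coef_poly ltnS.
case: ltnP => [ip|pi]; last by rewrite mul0rn nth_default.
by rewrite -[LHS]mulr_natr /= divfK// pnatr_eq0.
Qed.

Lemma poly_double_root (p : {poly R}) : p.[-1] = 0 -> p.[1] = 0 ->
  exists q : {poly R}, p = (1 - 'X ^+ 2) * q.
Proof.
move=> pN1 p1; have /factor_theorem[q pq] : root p 1 by exact/rootP.
have /factor_theorem[r qr] : root q (-1).
  apply/rootP; move: pN1; rewrite pq !hornerE => /eqP.
  rewrite mulf_eq0 => /orP[/eqP//|].
  by rewrite -opprD oppr_eq0 -(natrD _ 1 1) pnatr_eq0.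
by exists (- r); rewrite pq qr polyCN opprK polyC1; ring.
Qed.

Lemma mvt_bound f (df : R -> R) (a b M : R) : a <= b ->
  (forall x, a < x < b -> is_derive x 1 f (df x)) ->
  {within `[a, b], continuous f} ->
  (forall x, a <= x <= b -> `|df x| <= M) ->
  `|f b - f a| <= M * (b - a).
Proof.
move=> ab dfx cf dfM.
have dfx' x : x \in `]a, b[%R -> is_derive x 1 f (df x) by rewrite in_itv; exact: dfx.
have [c cab ->] := MVT_segment ab dfx' cf.
rewrite normrM (ger0_norm (_ : 0 <= b - a)) ?subr_ge0//.
by rewrite ler_wpM2r ?subr_ge0// dfM// -in_itv.
Qed.


(** The quantity h + 2 t g / (1 - t^2) is 1 - t^2 times the derivative of g / (1 - t^2). A
    polynomial [G] near g, with derivative near h and with the same zeros at -1 and 1, is divisible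
    by 1 - t^2; [q] is the quotient. *)
Lemma approx_weighted g h (e : R) : 0 < e -> continuous h ->
  {within `[-1, 1], continuous g} -> g (-1) = 0 -> g 1 = 0 ->
  (forall t : R, -1 < t < 1 -> is_derive t 1 g (h t)) ->
  exists q : {poly R}, forall t : R, -1 < t < 1 ->
    `|g t / (1 - t ^+ 2) - q.[t]| <= e /\
    `|h t + 2 * t * (g t / (1 - t ^+ 2)) - (1 - t ^+ 2) * q^`().[t]| <= e.
Proof.
move=> e0 ch cg gN1 g1 dg.
have N11 : -1 <= 1 :> R by lra.
(* The quotient is known up to 2 e', it enters the second estimate with the factor 2 |t| <= 2, and
   |G' - h| adds 2 e': in all 6 e'. *)
pose e' := e / 6; have e'0 : 0 < e' by rewrite divr_gt0.
have [p Hp] := @weierstrass R h (-1) 1 e' ltac:(lra) e'0 ch.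
have [P0 dP0] := poly_antiderivative p.
have cP (P : {poly R}) : {within `[-1, 1], continuous (fun t => P.[t])}.
  by apply: continuous_subspaceT => x; exact: continuous_horner.
have [P PN1 dP] : exists2 P, P.[-1] = 0 & P^`() = p.
  exists (P0 - P0.[-1]%:P); first by rewrite !hornerE subrr.
  by rewrite derivB derivC subr0.
pose c := P.[1] / 2.
have dB (P1 : {poly R}) (t : R) : -1 < t < 1 ->
    is_derive t 1 (fun t => P1.[t] - g t) (P1^`().[t] - h t).
  by move=> t1; have := dg _ t1; have := is_derive_poly P1 t => *; exact: is_deriveB.
have cB (P1 : {poly R}) : {within `[-1, 1], continuous (fun t => P1.[t] - g t)}.
  by move=> t; apply: cvgB; [exact: cP|exact: cg].
have c_le : `|c| <= e'.
  have := @mvt_bound (fun t => P.[t] - g t) (fun t => P^`().[t] - h t) (-1) 1 e'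
    N11 (dB P) (cB P).
  rewrite PN1 gN1 g1 !subr0 /c normrM (@ger0_norm _ 2^-1) ?invr_ge0// opprK.
  rewrite ler_pdivrMr//; apply => t t1.
  by rewrite dP distrC; exact: Hp.
(* The linear term restores the zero at 1 without disturbing the one at -1. Its slope is small
   because 2 c = P(1) - g(1), where P - g vanishes at -1 and has derivative p - h. *)
pose G := P - c *: ('X + 1).
have [q Gq] : exists q : {poly R}, G = (1 - 'X ^+ 2) * q.
  apply: poly_double_root.
    by rewrite /G !hornerE PN1; ring.
  by rewrite /G !hornerE /c; field.
have dG t : G^`().[t] = p.[t] - c.
  by rewrite /G derivB derivZ (derivD 'X) derivX dP -polyC1 derivC !hornerE.
have dG_le (t : R) : -1 <= t <= 1 -> `|G^`().[t] - h t| <= 2 * e'.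
  move=> /Hp; rewrite dG distrC addrAC => H.
  by rewrite (le_trans (ler_normB _ _))// mulr_natl mulr2n lerD.
have qG t : G.[t] = (1 - t ^+ 2) * q.[t] by rewrite Gq !hornerE.
have dqG t : (1 - t ^+ 2) * q^`().[t] = G^`().[t] + 2 * t * q.[t].
  by rewrite Gq derivM derivB derivXn -polyC1 derivC !hornerE; ring.
exists q => t /[dup] t11 /andP[t1 t2].
have GN1 : G.[-1] = 0 by rewrite qG; ring.
have G1 : G.[1] = 0 by rewrite qG; ring.
(* The mean value bound is taken from the nearer endpoint, at distance 1 - |t| <= 1 - t^2. From one
   fixed endpoint the decay at the other would be lost. *)
have d_le : `|G.[t] - g t| <= 2 * e' * (1 - t ^+ 2).
  have Hl : `|G.[t] - g t| <= 2 * e' * (t + 1).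
    have := @mvt_bound (fun t => G.[t] - g t) (fun t => G^`().[t] - h t) (-1) t (2 * e').
    rewrite GN1 gN1 !subr0 opprK; apply; first exact: ltW.
    - by move=> x /andP[x1 xt]; apply: dB; rewrite x1 (lt_trans xt).
    - apply: continuous_subspaceW (cB G) => x /=; rewrite !in_itv/= => /andP[-> xt].
      by rewrite (le_trans xt)// ltW.
    - by move=> x /andP[x1 xt]; apply: dG_le; rewrite x1 (le_trans xt)// ltW.
  have Hr : `|G.[t] - g t| <= 2 * e' * (1 - t).
    have := @mvt_bound (fun t => G.[t] - g t) (fun t => G^`().[t] - h t) t 1 (2 * e').
    rewrite G1 g1 !subr0 sub0r normrN; apply; first exact: ltW.
    - by move=> x /andP[xt x1]; apply: dB; rewrite x1 (lt_trans _ xt).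
    - apply: continuous_subspaceW (cB G) => x /=; rewrite !in_itv/= => /andP[xt ->].
      by rewrite andbT (le_trans _ xt)// ltW.
    - by move=> x /andP[xt x1]; apply: dG_le; rewrite x1 (le_trans _ xt)// ltW.
  have [t0|t0] := leP 0 t; nra.
have t20 : 0 < 1 - t ^+ 2 by nra.
have kq : `|g t / (1 - t ^+ 2) - q.[t]| <= 2 * e'.
  rewrite distrC; have -> : q.[t] - g t / (1 - t ^+ 2) = (G.[t] - g t) / (1 - t ^+ 2).
    by rewrite qG; field; rewrite lt0r_neq0.
  by rewrite normrM normfV (gtr0_norm t20) ler_pdivrMr.
have e'E : e = 6 * e' by rewrite /e'; field.
split; first by rewrite (le_trans kq)// e'E; lra.
have -> : h t + 2 * t * (g t / (1 - t ^+ 2)) - (1 - t ^+ 2) * q^`().[t] =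
    2 * t * (g t / (1 - t ^+ 2) - q.[t]) - (G^`().[t] - h t).
  by rewrite dqG; ring.
rewrite (le_trans (ler_normB _ _))// e'E (_ : 6 * e' = 2 * (2 * e') + 2 * e'); last by ring.
rewrite lerD//; last by rewrite dG_le// !ltW.
rewrite normrM ler_pM// normrM (ger0_norm (ler0n _ _)) ler_piMr//.
by rewrite ler_norml !ltW.
Qed.

End weighted_approximation.

(** * Approximation of kappa and of its derivative *)

Section kappa_approximation.
Context {R : realType}.
Notation leb := (@lebesgue_measure R).
Variables (psi p : R -> R).
Hypothesis cp : continuous p.
Hypothesis psip : forall t : R, -1 <= t <= 1 -> psi t = p t.
Hypothesis intp : 2 * pi * \int[leb]_(t in `[-1, 1]) p t = 1.

Let h t : R := 1 - 4 * pi * p t.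
Let g t : R := \int[leb]_(s in `[-1, t]) h s.

Let ch : continuous h.
Proof.
by move=> t; apply: cvgB; [exact: cvg_cst|apply: cvgM; [exact: cvg_cst|exact: cp]].
Qed.

Lemma continuous_segment_integrable (f : R -> R) (a b : R) : continuous f ->
  leb.-integrable `[a, b] (EFin \o f).
Proof.
move=> cf; apply: continuous_compact_integrable; first exact: segment_compact.
exact: continuous_subspaceT.
Qed.

Let gN1 : g (-1) = 0.
Proof. by rewrite /g set_itv1 Rintegral_set1. Qed.

(** The normalization 2 pi int p = 1 gives 2 - 4 pi / (2 pi) = 0. This is what removes the pole of 1
    / (1 - t^2) at t = 1. *)
Let g1 : g 1 = 0.
Proof.
rewrite /g /h RintegralB//=; last 2 first.
- exact: (@continuous_segment_integrable (cst 1) (-1) 1 (fun x => cvg_cst _)).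
- apply: (@continuous_segment_integrable (fun t => 4 * pi * p t)) => t.
  by apply: cvgM; [exact: cvg_cst|exact: cp].
rewrite RintegralZl//; last exact: continuous_segment_integrable.
rewrite Rintegral_cst//= lebesgue_measure_itv/= lte_fin.
rewrite ifT; last by lra.
rewrite (_ : 4 * pi * _ = 2 * (2 * pi * \int[leb]_(t in `[-1, 1]) p t)); last by ring.
by rewrite intp/=; ring.
Qed.

Let dg (t : R) : -1 < t < 1 -> is_derive t 1 g (h t).
Proof.
move=> /andP[t1 t2].
have [||dgt gt] := @continuous_FTC1_closed R h (-1) t 1 t2 _ t1.
- exact: continuous_segment_integrable.
- exact: ch.
by rewrite -gt derive1E; apply: DeriveDef.
Qed.

Let cg : {within `[-1, 1], continuous g}.
Proof.
apply: parameterized_integral_continuous; first lra.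
exact: continuous_segment_integrable.
Qed.

Let kappaE (t : R) : -1 < t < 1 -> kappa psi t = (4 * pi)^-1 * (g t / (1 - t ^+ 2)).
Proof.
move=> t11; rewrite /kappa /continuous_extension ifT; last first.
  by rewrite inE/= in_itv.
rewrite invfM -mulrA; congr (_ * _); rewrite mulrC; congr (_ / _).
apply: eq_Rintegral => s; rewrite inE/= in_itv/= => /andP[s1 st].
rewrite psip// s1 (le_trans st)//; case/andP: t11 => _; exact: ltW.
Qed.

Let dkappaE (t : R) : -1 < t < 1 ->
  derive1 (kappa psi) t =
  (4 * pi)^-1 * ((h t + 2 * t * (g t / (1 - t ^+ 2))) / (1 - t ^+ 2)).
Proof.
move=> t11; rewrite derive1E.
have t20 : 1 - t ^+ 2 != 0 by rewrite lt0r_neq0//; case/andP: t11 => *; nra.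
rewrite (@near_eq_derive _ _ _ _ (fun t => (4 * pi)^-1 * (g t / (1 - t ^+ 2)))); last first.
  have : \forall s \near t, s \in `]-1, 1[%R by exact: near_in_itvoo.
  by apply: filterS => s; rewrite in_itv/=; exact: kappaE.
have d1 := dg t11.
have d2 : is_derive t 1 (fun t => 1 - t ^+ 2) (- (2 * t)).
  have -> : (fun t : R => 1 - t ^+ 2) = horner (1 - 'X ^+ 2).
    by apply/funext => s; rewrite !hornerE.
  apply: is_derive_eq.
  by rewrite derivB derivXn -polyC1 derivC !hornerE mulr_natl.
have d3 := @is_deriveV _ (fun t => 1 - t ^+ 2) t _ 1 t20 d2.
have d4 := is_deriveM d1 d3.
have d5 := is_deriveZ (4 * pi)^-1 d4.
case: d5 => _ /= ->.
rewrite -![_ *: _]/(_ * _); congr (_ * _).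
set X := 1 - _ ^+ 2 in t20 *.
rewrite /GRing.exp/=.
by field.
Qed.

Lemma kappa_approx (e : R) : 0 < e -> exists q : {poly R}, forall t : R, -1 < t < 1 ->
  `|kappa psi t - q.[t]| <= e /\
  (1 - t ^+ 2) * `|derive1 (kappa psi) t - q^`().[t]| <= e.
Proof.
move=> e0; have pi40 : 0 < 4 * pi :> R by rewrite mulr_gt0// pi_gt0.
have [q Hq] := approx_weighted (mulr_gt0 pi40 e0) ch cg gN1 g1 dg.
exists ((4 * pi)^-1 *: q) => t t11; have [H1 H2] := Hq t t11.
have t20 : 0 < 1 - t ^+ 2 by case/andP: t11 => *; nra.
rewrite kappaE// dkappaE// derivZ !hornerZ -!mulrBr !normrM.
rewrite gtr0_norm ?invr_gt0//; split; first by rewrite ler_pdivrMl.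
rewrite mulrCA ler_pdivrMl// (le_trans _ H2)//.
rewrite -{1}(gtr0_norm t20) -normrM mulrBr [X in X - _]mulrC divfK//.
by rewrite lt0r_neq0.
Qed.

End kappa_approximation.

(** * Surface measure and integrals of polynomials *)

Section sphere_measure.
Context {R : realType}.
Local Notation mu := (surface_measure R).
Local Notation leb := (@lebesgue_measure R).
Local Notation cV := 'cV[R]_3.
Local Notation TR := (measurableTypeR R).
Implicit Types (x y : cV) (f : cV -> R).

Lemma dotE x y : dot x y = \sum_i x i 0 * y i 0.
Proof. by rewrite /dot mxE; apply: eq_bigr => i _; rewrite mxE. Qed.

Lemma dotE3 x y : dot x y = x 0 0 * y 0 0 + x 1 0 * y 1 0 + x 2 0 * y 2 0.
Proof.
rewrite dotE !big_ord_recr big_ord0/= add0r.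
by congr (_ * _ + _ * _ + _ * _); congr (_ _ _); apply/val_inj.
Qed.

Lemma S2E x : S2 x <-> dot x x = 1.
Proof.
rewrite /S2 /enorm /=; split=> [x1|->]; last exact: sqrtr1.
rewrite -[LHS]sqr_sqrtr ?x1 ?expr1n// dotE sumr_ge0// => i _.
by rewrite -expr2 sqr_ge0.
Qed.

Lemma S2_coord_le x (i : 'I_3) : S2 x -> `|x i 0| <= 1.
Proof.
move=> /S2E; rewrite dotE (bigD1 i)//= => x1.
rewrite -(@ler_pXn2r _ 2)// ?nnegrE// expr1n -normrX ger0_norm ?sqr_ge0// -x1 expr2.
by rewrite lerDl sumr_ge0// => j _; rewrite -expr2 sqr_ge0.
Qed.

Lemma measurable_coord (i : 'I_3) : measurable_fun [set: cV] (fun x : cV => x i 0).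
Proof.
move=> _ Y mY; rewrite setTI; apply: sub_sigma_algebra => /=.
rewrite -bigcup_seq/=; exists i => /=; first by rewrite mem_index_enum.
by exists Y => //; rewrite setTI.
Qed.

Lemma measurable_S2 : measurable (@S2 R).
Proof.
have md : measurable_fun [set: cV] (fun x : cV => dot x x).
  under eq_fun do rewrite dotE3.
  by do !apply: measurable_funD; apply: measurable_funM; exact: measurable_coord.
rewrite (_ : S2 = (fun x : cV => dot x x) @^-1` [set 1]).
  by rewrite -[X in measurable X]setTI; exact: md.
by apply/seteqP; split=> x /S2E.
Qed.
Hint Resolve measurable_S2 : core.

Lemma measurable_fun_cvec_within (D : set cV) (F : cV -> cV) : measurable D ->
  (forall i : 'I_3, measurable_fun D (fun x => F x i 0)) -> measurable_fun D F.
Proof.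
move=> mD mF; pose G x := if x \in D then F x else 0.
apply: (@eq_measurable_fun _ _ _ _ D G) => [x xD|]; first by rewrite /G xD.
apply: measurable_funTS; apply: measurable_fun_cvec => i.
have -> : (fun x => G x i 0) = (fun x => F x i 0) \_ D.
  by apply/funext => x; rewrite /G patchE; case: ifP => //; rewrite mxE.
by apply/(measurable_restrictT _ _).1 => //; exact: mF.
Qed.

Lemma measurable_fun_cvecE (D : set cV) (F : cV -> cV) (i : 'I_3) : measurable D ->
  measurable_fun D F -> measurable_fun D (fun x => F x i 0).
Proof.
move=> mD mF; exact: (measurableT_comp (@measurable_coord i) mF).
Qed.

Let nu : set (TR * TR) -> \bar R := mrestr (leb \x leb)%E (@measurable_param_domain R).

Lemma param_domain_finite : ((leb \x leb) (@param_domain R) < +oo)%E.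
Proof.
rewrite /param_domain product_measure1E//= !lebesgue_measure_itv/= !lte_fin.
by do 2!case: ifP => _; rewrite -?EFinB -?EFinM ?mule0 ?mul0e ltry.
Qed.

Lemma surface_measure_finite : (mu [set: cV] < +oo)%E.
Proof.
rewrite /surface_measure/= /pushforward preimage_setT /mrestr setTI.
exact: param_domain_finite.
Qed.

Lemma surface_measure_S2_finite : (mu S2 < +oo)%E.
Proof.
by rewrite (le_lt_trans _ surface_measure_finite)// le_measure// inE.
Qed.

Lemma measurable_cvec1 x : measurable [set x].
Proof.
rewrite (_ : [set x] = \bigcap_(i in [set: 'I_3]) ((fun y : cV => y i 0) @^-1` [set x i 0])).
  apply: fin_bigcap_measurable => // i _.
  by rewrite -[X in measurable X]setTI; exact: measurable_coord.
apply/seteqP; split=> [y -> //|y H]; apply/colP => i; exact: H.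
Qed.

(** Within the parameter rectangle, the preimage of a point lies on one segment of constant height,
    whose area is zero. *)
Lemma surface_measure_set1 x : mu [set x] = 0%E.
Proof.
have mx := measurable_cvec1 x.
rewrite /surface_measure/= /pushforward /mrestr.
apply/eqP; rewrite -measure_le0.
have mZ : measurable ([set x 2 0] `*` `[0, 2 * pi]%classic : set (R * R)).
  by apply: measurableX.
apply: (@le_trans _ _ ((leb \x leb)%E ([set x 2 0] `*` `[0, 2 * pi]%classic))).
  apply: le_measure; rewrite ?inE//.
    apply: measurableI => //; last exact: measurable_param_domain.
    by rewrite -[X in measurable X]setTI; exact: measurable_sphere_param.
  move=> [z t] [/= <- [_ /= tpi]]; split => //=.
  by rewrite mxE.
by rewrite /= product_measure1E//= lebesgue_measure_set1 mul0e.
Qed.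

Lemma sphere_param_S2 (p : R * R) : param_domain p -> S2 (sphere_param p).
Proof.
move=> [/=]; rewrite in_itv/= => /andP[z1 z2] _.
apply/S2E; rewrite dotE3 !mxE/=.
have H := cos2Dsin2 p.2; have : 0 <= 1 - p.1 ^+ 2 by nra.
move=> /sqr_sqrtr E.
rewrite (_ : _ + _ = Num.sqrt (1 - p.1 ^+ 2) ^+ 2 * (cos p.2 ^+ 2 + sin p.2 ^+ 2) +
  p.1 ^+ 2); last by ring.
by rewrite H E mulr1 subrK.
Qed.

(** Fubini in the coordinates (z, theta), in which the area element is 1. The bound [M], on a set of
    finite measure, supplies the integrability needed to transport the integral to the parameter
    plane. *)
Lemma sphere_Rintegral_sep f (a b : R -> R) (M : R) :
  measurable_fun [set: cV] f -> (forall x, S2 x -> `|f x| <= M) ->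
  continuous a -> continuous b ->
  (forall z t : R, -1 <= z <= 1 -> f (sphere_param (z, t)) = a z * b t) ->
  \int[mu]_(x in S2) f x =
  (\int[leb]_(z in `[-1, 1]) a z) * (\int[leb]_(t in `[0, 2 * pi]) b t).
Proof.
move=> mf fM ca cb fab.
pose sigma : TR * TR -> cV := @sphere_param R.
have msigma : measurable_fun [set: TR * TR] sigma := @measurable_sphere_param R.
pose D : set (TR * TR) := @param_domain R.
have mD : measurable D := @measurable_param_domain R.
have mS : measurable (sigma @^-1` S2).
  by rewrite -[X in measurable X]setTI; exact: msigma.
have nufin : (nu (sigma @^-1` S2) < +oo)%E.
  rewrite (le_lt_trans _ param_domain_finite)// /nu/= /mrestr.
  by rewrite le_measure// ?inE//; exact: measurableI.
have mfs : measurable_fun [set: TR * TR] (f \o sigma).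
  exact: (measurableT_comp mf msigma).
have i1 : nu.-integrable (sigma @^-1` S2) (EFin \o (f \o sigma)).
  apply: measurable_bounded_integrable => //; first exact: measurable_funTS.
  exists M; split; first exact: num_real.
  by move=> N MN p /= Sp; rewrite (le_trans (fM _ Sp))// ltW.
rewrite /Rintegral.
have -> : (\int[mu]_(x in S2) (f x)%:E =
           \int[nu]_(p in sigma @^-1` S2) (f (sigma p))%:E)%E.
  have mEf : measurable_fun [set: cV] (EFin \o f) by exact/measurable_EFinP.
  have := integral_pushforward msigma mEf i1 measurable_S2.
  by rewrite /comp => <-; exact: eq_measure_integral.
(* The parametrization also maps points outside the rectangle to the sphere, since theta is
   unrestricted there; they are null for [nu]. *)
rewrite (@negligible_integral _ _ _ _ _ (sigma @^-1` S2 `\` D))//=; last 2 first.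
- exact: measurableD.
- by rewrite /nu /= /mrestr setDKI measure0.
rewrite setDD setIidr; last exact: sphere_param_S2.
rewrite (@eq_measure_integral _ _ _ _ (leb \x leb)%E); last first.
  by move=> A mA AD; rewrite /nu/= /mrestr setIidl.
pose a' := a \_ `[-1, 1]; pose b' := b \_ `[0, 2 * pi].
have ia : leb.-integrable [set: R] (EFin \o a').
  rewrite /a' -restrict_EFin; apply/integrable_restrict => //.
  by rewrite setTI; exact: continuous_segment_integrable.
have ib : leb.-integrable [set: R] (EFin \o b').
  rewrite /b' -restrict_EFin; apply/integrable_restrict => //.
  by rewrite setTI; exact: continuous_segment_integrable.
have ma : measurable_fun [set: R] a'.
  by apply/measurable_EFinP; case/integrableP : ia.
have mb : measurable_fun [set: R] b'.
  by apply/measurable_EFinP; case/integrableP : ib.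
have -> : (\int[leb \x leb]_(p in D) (f (sigma p))%:E =
           \int[leb \x leb]_p (a' p.1 * b' p.2)%:E)%E.
  rewrite integral_mkcond; apply: eq_integral => -[z t] _.
  rewrite patchE; case: ifPn => [|nD].
    rewrite inE => -[/= z1 t1].
    by rewrite /a' /b' !patchE !mem_set//= fab//; move: z1; rewrite in_itv.
  rewrite /a' /b' !patchE/=; case: ifPn => z1; rewrite ?mul0r//.
  case: ifPn => t1; rewrite ?mulr0//; move: nD; rewrite notin_setE => -[].
  by split; [move: z1|move: t1]; rewrite inE.
have iab : (leb \x leb)%E.-integrable [set: R * R] (fun p => (a' p.1 * b' p.2)%:E).
  apply/integrable12ltyP => /=.
    apply/measurable_EFinP; apply: measurable_funM.
      exact: (measurableT_comp ma measurable_fst).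
    exact: (measurableT_comp mb measurable_snd).
  have na : leb.-integrable [set: R] (fun z => `|(a' z)%:E|%E) by exact: integrable_abse.
  have nb : leb.-integrable [set: R] (fun t => `|(b' t)%:E|%E) by exact: integrable_abse.
  have E1 z : (\int[leb]_t `|(a' z * b' t)%:E| = `|(a' z)%:E| * \int[leb]_t `|(b' t)%:E|)%E.
    under eq_integral do rewrite EFinM abseM.
    exact: integralZl.
  under eq_integral do rewrite E1.
  have [_ nbfin] := (elimT (integrableP _ _ _) ib).
  have Bfin : (\int[leb]_t `|(b' t)%:E|)%E \is a fin_num.
    by rewrite ge0_fin_numE// integral_ge0.
  rewrite -(fineK Bfin) integralZr//.
  have [_ nafin] := (elimT (integrableP _ _ _) ia).
  have Afin : (\int[leb]_t `|(a' t)%:E|)%E \is a fin_num.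
    by rewrite ge0_fin_numE// integral_ge0.
  by rewrite -(fineK Afin) -EFinM ltry.
rewrite -(integral12_prod_meas1 iab) /fubini_F/=.
have Eb (z : R) : (\int[leb]_t (a' z * b' t)%:E = (a' z * \int[leb]_t b' t)%:E)%E.
  rewrite EFinM [X in (_ * X)%E]fineK; last exact: integrable_fin_num.
  by under [LHS]eq_integral do rewrite EFinM; exact: integralZl.
under eq_integral do rewrite Eb.
transitivity (\int[leb]_z (a' z * \int[leb]_t b' t)); first by [].
by rewrite RintegralZr// /a' /b' -!Rintegral_mkcond.
Qed.

End sphere_measure.

(** * Recursions for the angular and the height integrals of monomials *)

Section one_dimensional_integrals.
Context {R : realType}.
Local Notation leb := (@lebesgue_measure R).

Lemma Rintegral_FTC2 (F f : R -> R) (a b : R) : a < b ->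
  (forall x : R, is_derive x 1 F (f x)) -> continuous f ->
  \int[leb]_(x in `[a, b]) f x = F b - F a.
Proof.
move=> ab dF cf; rewrite /Rintegral.
have cF : continuous F.
  by move=> x; apply/differentiable_continuous/derivable1_diffP; case: (dF x).
rewrite (@continuous_FTC2 _ _ F)//.
- exact: continuous_subspaceT.
- split=> [x _||]; first by case: (dF x).
    by apply: cvg_at_right_filter; exact: cF.
  by apply: cvg_at_left_filter; exact: cF.
- by move=> x _; rewrite derive1E; case: (dF x).
Qed.

Definition trig_int (a b : nat) : R :=
  \int[leb]_(t in `[0, 2 * pi]) (cos t ^+ a * sin t ^+ b).

Lemma continuous_trig (a b : nat) : continuous (fun t : R => cos t ^+ a * sin t ^+ b).
Proof.
move=> t; apply: cvgM.
  exact: (continuous_comp (@continuous_cos R t) (@exprn_continuous R a _)).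
exact: (continuous_comp (@continuous_sin R t) (@exprn_continuous R b _)).
Qed.

Lemma is_derive_expn (f : R -> R) (n : nat) (x df : R) : is_derive x 1 f df ->
  is_derive x 1 (fun t => f t ^+ n) (n%:R * f x ^+ n.-1 * df).
Proof.
move=> dfx; have -> : (fun t => f t ^+ n) = f ^+ n by rewrite exprfctE.
exact: is_deriveX.
Qed.

(** The derivative of cos^a sin^b integrates to zero over a full period. Where a = 0 or b = 0, the
    truncated exponent comes with the factor 0. *)
Lemma trig_int_rec (a b : nat) :
  b%:R * trig_int a.+1 b.-1 = a%:R * trig_int a.-1 b.+1.
Proof.
have i k l : leb.-integrable `[0, 2 * pi] (EFin \o (fun t : R => cos t ^+ k * sin t ^+ l)).
  exact/continuous_segment_integrable/continuous_trig.
have c k l (c : R) : continuous (fun t : R => c * (cos t ^+ k * sin t ^+ l)).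
  by move=> t; apply: cvgM; [exact: cvg_cst|exact: continuous_trig].
apply/eqP; rewrite -subr_eq0 /trig_int -!RintegralZl// -RintegralB//=; last 2 first.
- exact/continuous_segment_integrable/c.
- exact/continuous_segment_integrable/c.
apply/eqP; pose F t : R := cos t ^+ a * sin t ^+ b.
transitivity (F (2 * pi) - F 0); last first.
  by rewrite /F mulr_natl sin2pi cos2pi sin0 cos0 subrr.
apply: Rintegral_FTC2; first by rewrite mulr_gt0// pi_gt0.
- move=> t; have dc := is_derive_expn a (is_derive_cos t).
  have ds := is_derive_expn b (is_derive_sin t).
  apply: (is_derive_eq (is_deriveM dc ds)).
  rewrite -![_ *: _]/(_ * _) /= !exprS; ring.
- by move=> t; apply: cvgB; exact: c.
Qed.

Lemma trig_int_split (a b : nat) :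
  trig_int a.+2 b + trig_int a b.+2 = trig_int a b.
Proof.
rewrite /trig_int -RintegralD//; last 2 first.
- exact/continuous_segment_integrable/continuous_trig.
- exact/continuous_segment_integrable/continuous_trig.
apply: eq_Rintegral => t _.
rewrite -[RHS]mulr1 -(cos2Dsin2 t) !exprS; ring.
Qed.

Lemma trig_int_cos (a b : nat) : (a + b).+2%:R * trig_int a.+2 b = a.+1%:R * trig_int a b.
Proof.
have := trig_int_rec a.+1 b.+1; have := trig_int_split a b => <- /=.
rewrite -addSn -addnS natrD mulrDl mulrDr => ->; ring.
Qed.

Lemma trig_int_sin (a b : nat) : (a + b).+2%:R * trig_int a b.+2 = b.+1%:R * trig_int a b.
Proof.
have := trig_int_rec a.+1 b.+1; have := trig_int_split a b => <- /=.
rewrite -addSn -addnS natrD mulrDl mulrDr => ->; ring.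
Qed.

Lemma trig_int_cos1 (b : nat) : trig_int 1 b = 0.
Proof.
have /eqP := trig_int_rec 0 b.+1; rewrite mul0r mulf_eq0 pnatr_eq0/=.
by move/eqP.
Qed.

Lemma trig_int_sin1 (a : nat) : trig_int a 1 = 0.
Proof.
have /esym/eqP := trig_int_rec a.+1 0; rewrite mul0r mulf_eq0 pnatr_eq0/=.
by move/eqP.
Qed.

Lemma trig_int_odd (a b : nat) : odd a || odd b -> trig_int a b = 0.
Proof.
have Ha (k : nat) : trig_int k.*2.+1 b = 0.
  elim: k => [|k IHk]; first exact: trig_int_cos1.
  apply/eqP; have /eqP := trig_int_cos k.*2.+1 b.
  by rewrite IHk mulr0 mulf_eq0 pnatr_eq0.
have Hb (k : nat) : trig_int a k.*2.+1 = 0.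
  elim: k => [|k IHk]; first exact: trig_int_sin1.
  apply/eqP; have /eqP := trig_int_sin a k.*2.+1.
  by rewrite IHk mulr0 mulf_eq0 pnatr_eq0.
move=> /orP[oa|ob].
  by rewrite -(odd_double_half a) oa add1n.
by rewrite -(odd_double_half b) ob add1n.
Qed.

(** Here n stands for the total exponent a + b of the first two coordinates. If it is odd, one of a
    and b is odd and the angular integral vanishes, so that only even n, where the integrand is a
    polynomial on [-1, 1], has to be computed. *)
Definition height_int (n c : nat) : R :=
  \int[leb]_(z in `[-1, 1]) (Num.sqrt (1 - z ^+ 2) ^+ n * z ^+ c).

Lemma Rintegral_deriv (p : {poly R}) :
  \int[leb]_(z in `[-1, 1]) (p^`().[z]) = p.[1] - p.[-1].
Proof.
apply: Rintegral_FTC2; first by lra.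
exact: continuous_horner.
Qed.

Let P (j c : nat) : {poly R} := (1 - 'X ^+ 2) ^+ j * 'X ^+ c.

Let PE (j c : nat) (z : R) : (P j c).[z] = (1 - z ^+ 2) ^+ j * z ^+ c.
Proof. by rewrite /P !hornerE. Qed.

Lemma height_int_even (j c : nat) :
  height_int j.*2 c = \int[leb]_(z in `[-1, 1]) ((P j c).[z]).
Proof.
apply: eq_Rintegral => z; rewrite inE/= in_itv/= => /andP[z1 z2].
by rewrite PE -muln2 mulnC exprM sqr_sqrtr//; nra.
Qed.

Let intP (j c : nat) : leb.-integrable `[-1, 1] (EFin \o (fun z => (P j c).[z])).
Proof. exact/continuous_segment_integrable/continuous_horner. Qed.

Let dP (j c : nat) :
  (P j.+1 c)^`() = - (j.+1.*2%:R) *: P j c.+1 + c%:R *: P j.+1 c.-1.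
Proof.
rewrite /P derivM derivXn deriv_exp derivB derivXn -polyC1 derivC sub0r polyC1 /=.
rewrite expr1 scaleNr !scaler_nat -!mulrnAr; congr (_ + _).
set A := (1 - _) ^+ j; rewrite exprS; move: A ('X^c) => A V.
by rewrite -muln2 mulrnA -(mulr_natl A) -(mulr_natl (_ * V)); ring.
Qed.

Let PI j c : R := \int[leb]_(z in `[-1, 1]) ((P j c).[z]).

Let PI_rec (j c : nat) : j.+1.*2%:R * PI j c.+1 = c%:R * PI j.+1 c.-1.
Proof.
have := Rintegral_deriv (P j.+1 c).
have -> : (P j.+1 c).[1] = 0 by rewrite PE expr1n subrr exprS !mul0r.
have -> : (P j.+1 c).[-1] = 0 by rewrite PE sqrrN expr1n subrr exprS !mul0r.
rewrite subrr dP.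
under eq_Rintegral do rewrite hornerD !hornerZ mulNr addrC.
have i k l (a : R) :
    leb.-integrable `[-1, 1] (EFin \o (fun z => a * (P k l).[z])).
  apply: continuous_segment_integrable => z.
  by apply: cvgM; [exact: cvg_cst|exact: continuous_horner].
rewrite (RintegralB _ (i _ _ _) (i _ _ _))//.
by rewrite !RintegralZl// => /eqP; rewrite subr_eq0 => /eqP.
Qed.

Let PI_split (j c : nat) : PI j c.+2 + PI j.+1 c = PI j c.
Proof.
rewrite /PI -RintegralD//; apply: eq_Rintegral => z _.
by rewrite !PE !exprS; ring.
Qed.

Lemma height_int_z (j c : nat) :
  (j.*2 + c).+2%:R * height_int j.*2 c.+1 = c%:R * height_int j.*2 c.-1.
Proof.
rewrite !height_int_even -/(PI _ _) -/(PI _ _); have := PI_rec j c.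
case: c => [|c]; first by rewrite !mul0r addn0 doubleS.
rewrite succnK -(PI_split j c) mulrDr => <-; rewrite -mulrDl -natrD.
by congr (_%:R * _); rewrite doubleS addnC !addSn !addnS.
Qed.

Lemma height_int_r (j c : nat) :
  (j.*2 + c).+3%:R * height_int j.+1.*2 c = j.+1.*2%:R * height_int j.*2 c.
Proof.
rewrite !height_int_even -/(PI _ _) -/(PI _ _); have := PI_rec j c.+1.
rewrite succnK -(PI_split j c) mulrDr => ->; rewrite -mulrDl -natrD.
by congr (_%:R * _); rewrite doubleS addnC !addSn !addnS.
Qed.

End one_dimensional_integrals.

(** * Integration by parts for polynomials on the sphere *)

Section sphere_polynomials.
Context {R : realType}.
Local Notation mu := (surface_measure R).
Local Notation cV := 'cV[R]_3.
Local Notation mp := (mpoly.mpoly 3 R).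
Local Notation D := mpoly.mderiv.
Implicit Types (x y : cV) (p q : mp) (m : mpoly.multinom 3).

Definition ev y p : R := mpoly.meval (fun i => y i 0) p.

Definition mX (i : 'I_3) : mp := mpoly.mpolyX R (mpoly.mnm1 i).

Lemma evD y p q : ev y (p + q) = ev y p + ev y q. Proof. exact: mpoly.mevalD. Qed.
Lemma evB y p q : ev y (p - q) = ev y p - ev y q. Proof. exact: mpoly.mevalB. Qed.
Lemma evM y p q : ev y (p * q) = ev y p * ev y q. Proof. exact: mpoly.mevalM. Qed.
Lemma evZ y (c : R) p : ev y (c *: p) = c * ev y p. Proof. exact: mpoly.mevalZ. Qed.
Lemma evX y (i : 'I_3) : ev y (mX i) = y i 0. Proof. exact: mpoly.mevalXU. Qed.
Lemma ev1 y : ev y 1 = 1. Proof. exact: mpoly.meval1. Qed.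
Lemma ev0 y : ev y 0 = 0. Proof. exact: mpoly.meval0. Qed.
Lemma ev_sum y (I : Type) (r : seq I) (P : pred I) (F : I -> mp) :
  ev y (\sum_(i <- r | P i) F i) = \sum_(i <- r | P i) ev y (F i).
Proof. exact: raddf_sum. Qed.

Lemma sum3 (V : nmodType) (F : 'I_3 -> V) : \sum_i F i = F 0 + F 1 + F 2.
Proof.
rewrite !big_ord_recr big_ord0/= add0r.
by congr (F _ + F _ + F _); exact/val_inj.
Qed.

Lemma prod3 (F : 'I_3 -> R) : \prod_i F i = F 0 * F 1 * F 2.
Proof.
rewrite !big_ord_recr big_ord0/= mul1r.
by congr (F _ * F _ * F _); exact/val_inj.
Qed.

Lemma ev_monomial y m :
  ev y (mpoly.mpolyX R m) = y 0 0 ^+ (m 0) * y 1 0 ^+ (m 1) * y 2 0 ^+ (m 2).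
Proof. by rewrite /ev mpoly.mevalX prod3. Qed.

Lemma measurable_ev p : measurable_fun [set: cV] (ev ^~ p).
Proof.
elim/mpoly.mpolyind: p => [|c m p _ _ mp].
  by under eq_fun do rewrite ev0; exact: measurable_cst.
under eq_fun do rewrite evD evZ ev_monomial.
apply: measurable_funD => //; apply: measurable_funM; first exact: measurable_cst.
by do !apply: measurable_funM; apply: measurable_funX; exact: measurable_coord.
Qed.

Lemma ev_bounded p : exists M : R, forall y, S2 y -> `|ev y p| <= M.
Proof.
elim/mpoly.mpolyind: p => [|c m p _ _ [M HM]].
  by exists 0 => y _; rewrite ev0 normr0.
exists (`|c| + M) => y Sy; rewrite evD (le_trans (ler_normD _ _))// lerD ?HM//.
rewrite evZ normrM ler_piMr// ev_monomial !normrM !normrX.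
by do !apply: mulr_ile1; rewrite ?mulr_ge0 ?exprn_ge0 ?exprn_ile1 ?S2_coord_le.
Qed.

Lemma integrable_ev p : mu.-integrable S2 (EFin \o (ev ^~ p)).
Proof.
have [M HM] := ev_bounded p.
apply: measurable_bounded_integrable.
- exact: measurable_S2.
- exact: surface_measure_S2_finite.
- by apply: measurable_funTS; exact: measurable_ev.
- exists M; split; first exact: num_real.
  by move=> N MN y Sy /=; rewrite (le_trans (HM _ Sy))// ltW.
Qed.

Definition SI p : R := \int[mu]_(y in S2) ev y p.

Lemma SID p q : SI (p + q) = SI p + SI q.
Proof.
rewrite /SI -RintegralD//; [|exact: measurable_S2|exact: integrable_ev..].
by apply: eq_Rintegral => y _; rewrite evD.
Qed.

Lemma SIZ (c : R) p : SI (c *: p) = c * SI p.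
Proof.
rewrite /SI -RintegralZl//; [|exact: measurable_S2|exact: integrable_ev].
by apply: eq_Rintegral => y _; rewrite evZ.
Qed.

Lemma SI_is_linear : linear_for *%R SI.
Proof. by move=> c p q; rewrite SID SIZ. Qed.

HB.instance Definition _ := GRing.isLinear.Build R mp R *%R SI SI_is_linear.

Lemma SI_monomial m : SI (mpoly.mpolyX R m) =
  height_int (m 0 + m 1) (m 2) * trig_int (m 0) (m 1).
Proof.
have [M HM] := ev_bounded (mpoly.mpolyX R m).
apply: (sphere_Rintegral_sep (measurable_ev _) HM).
- move=> z; apply: cvgM; last exact: exprn_continuous.
  have c1 : {for z, continuous (fun z : R => 1 - z ^+ 2)}.
    by apply: cvgB; [exact: cvg_cst|exact: exprn_continuous].
  have c2 := continuous_comp c1 (@sqrt_continuous R _).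
  exact: (continuous_comp c2 (@exprn_continuous R _ _)).
- exact: continuous_trig.
- by move=> z t _; rewrite ev_monomial !mxE/= !exprMn exprD; ring.
Qed.

(** The angular exponents on the two sides have parities opposite to that of a and equal to that of
    b, so either both sides vanish or the height exponents are even. In that case the factor
    produced by the height recursion is exactly the one absorbed by the angular recursion. *)
Lemma monomial_rec_cos (a b c : nat) :
  (a + b + c).+2%:R * (height_int (a.+1 + b) c * trig_int a.+1 b) =
  a%:R * (height_int (a.-1 + b) c * trig_int a.-1 b) :> R.
Proof.
case: a => [|a]; first by rewrite trig_int_cos1 !mulr0 mul0r.
rewrite succnK; have [par|] := boolP (odd a || odd b).
  by rewrite !trig_int_odd ?mulr0//= negbK.
rewrite negb_or => /andP[/negbTE pa /negbTE pb].
have oab : odd (a + b) = false by rewrite oddD pa pb.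
have := odd_double_half (a + b); rewrite oab add0n => abE.
have := height_int_r (R := R) (a + b)./2 c; rewrite doubleS abE => hr.
have := trig_int_cos (R := R) a b => ht.
by rewrite addSn addSn mulrA hr -mulrA mulrCA ht mulrCA.
Qed.

Lemma monomial_rec_sin (a b c : nat) :
  (a + b + c).+2%:R * (height_int (a + b.+1) c * trig_int a b.+1) =
  b%:R * (height_int (a + b.-1) c * trig_int a b.-1) :> R.
Proof.
case: b => [|b]; first by rewrite trig_int_sin1 !mulr0 mul0r.
rewrite succnK; have [par|] := boolP (odd a || odd b).
  by rewrite !trig_int_odd ?mulr0//= negbK.
rewrite negb_or => /andP[/negbTE pa /negbTE pb].
have oab : odd (a + b) = false by rewrite oddD pa pb.
have := odd_double_half (a + b); rewrite oab add0n => abE.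
have := height_int_r (R := R) (a + b)./2 c; rewrite doubleS abE => hr.
have := trig_int_sin (R := R) a b => ht.
by rewrite !addnS addSn mulrA hr -mulrA mulrCA ht mulrCA.
Qed.

Lemma monomial_rec_height (a b c : nat) :
  (a + b + c).+2%:R * (height_int (a + b) c.+1 * trig_int a b) =
  c%:R * (height_int (a + b) c.-1 * trig_int a b) :> R.
Proof.
have [par|] := boolP (odd a || odd b); first by rewrite trig_int_odd// !mulr0.
rewrite negb_or => /andP[/negbTE pa /negbTE pb].
have oab : odd (a + b) = false by rewrite oddD pa pb.
have := odd_double_half (a + b); rewrite oab add0n => abE.
have := height_int_z (R := R) (a + b)./2 c; rewrite abE => hz.
by rewrite mulrA hz mulrA.
Qed.

Lemma SI_X_monomial (i : 'I_3) m :
  (mpoly.mdeg m).+2%:R * SI (mX i * mpoly.mpolyX R m) = SI (D i (mpoly.mpolyX R m)).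
Proof.
rewrite /mX -mpoly.mpolyXD mpoly.mderivX SIZ !SI_monomial mpoly.mdegE sum3.
rewrite !mpoly.mnmDE !mpoly.mnmBE !mpoly.mnm1E.
case: i => -[|[|[|//]]] i3; rewrite /eq_op /= ?add0n ?add1n ?subn0 ?subn1.
- rewrite (_ : Ordinal i3 = 0); last exact/val_inj.
  exact: monomial_rec_cos.
- rewrite (_ : Ordinal i3 = 1); last exact/val_inj.
  exact: monomial_rec_sin.
- rewrite (_ : Ordinal i3 = 2); last exact/val_inj.
  exact: monomial_rec_height.
Qed.

(** This is the divergence theorem on the unit ball: the integral of y_i p over the sphere is that
    of D_i p over the ball, and radial integration of a function of degree d - 1 gives the factor 1
    / (d + 2). *)
Lemma SI_X (i : 'I_3) (d : nat) p : homogeneous d p ->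
  d.+2%:R * SI (mX i * p) = SI (D i p).
Proof.
move=> /mpoly.dhomogP hp; rewrite {1 2}[p]mpoly.mpolyE.
rewrite (raddf_sum (D i)) mulr_sumr !(raddf_sum SI) mulr_sumr /=; apply: eq_big_seq => m mp.
by rewrite -scalerAr mpoly.mderivZ !SIZ mulrCA -(hp m mp) SI_X_monomial.
Qed.

End sphere_polynomials.

(** * Funk-Hecke formula *)

Section funk_hecke.
Context {R : realType}.
Local Notation mu := (surface_measure R).
Local Notation cV := 'cV[R]_3.
Local Notation mp := (mpoly.mpoly 3 R).
Local Notation D := mpoly.mderiv.
Implicit Types (x y : cV) (p q : mp) (i j k : 'I_3) (l n : nat).

Definition harmonic l p := homogeneous l p /\ mpoly_laplacian p = 0.

Definition lin x : mp := \sum_i x i 0 *: mX i.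

Lemma ev_lin y x : ev y (lin x) = dot x y.
Proof. by rewrite ev_sum dotE; apply: eq_bigr => i _; rewrite evZ evX. Qed.

Lemma D_mX i j : D i (mX j) = (i == j)%:R :> mp.
Proof.
rewrite /mX mpoly.mderivX mpoly.mnm1E eq_sym; case: eqVneq => [->|_].
  rewrite scale1r -mpoly.mpolyX0; congr mpoly.mpolyX.
  by apply/mpoly.mnmP => k; rewrite mpoly.mnmBE subnn mpoly.mnm0E.
by rewrite scale0r.
Qed.

Lemma D_lin i x : D i (lin x) = (x i 0)%:A.
Proof.
rewrite /lin raddf_sum (bigD1 i)//= mpoly.mderivZ D_mX eqxx big1 ?addr0// => j ji.
by rewrite mpoly.mderivZ D_mX eq_sym (negbTE ji) scaler0.
Qed.

Lemma D1 i : D i (1 : mp) = 0.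
Proof. by rewrite -mpoly.mpolyX0 mpoly.mderivX mpoly.mnm0E scale0r. Qed.

Lemma D_linX i x n : D i (lin x ^+ n) = n%:R * x i 0 *: lin x ^+ n.-1.
Proof.
elim: n => [|n IHn]; first by rewrite expr0 D1 mul0r scale0r.
rewrite exprS mpoly.mderivM IHn D_lin mulr_algl -scalerAr -natr1.
case: n IHn => [|n] _; first by rewrite !mul0r scale0r addr0 add0r mul1r expr0.
by rewrite -exprS -scalerDl mulrDl mul1r addrC.
Qed.

Lemma mX_D_monomial i (m : mpoly.multinom 3) :
  mX i * D i (mpoly.mpolyX R m) = (m i)%:R *: mpoly.mpolyX R m.
Proof.
rewrite mpoly.mderivX -scalerAr; have [->|mi0] := posnP (m i); first by rewrite !scale0r.
rewrite /mX -mpoly.mpolyXD; congr (_ *: mpoly.mpolyX R _).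
apply/mpoly.mnmP => k; rewrite mpoly.mnmDE mpoly.mnmBE mpoly.mnm1E.
by case: eqVneq => [<-|_] /=; rewrite ?subn0// subnKC.
Qed.

Lemma homog_D i l p : homogeneous l p -> homogeneous l.-1 (D i p).
Proof.
move=> /mpoly.dhomogP hp; rewrite /homogeneous [p]mpoly.mpolyE (raddf_sum (D i)) big_seq.
apply: rpred_sum => m pm /=; rewrite mpoly.mderivZ mpoly.mderivX; apply: rpredZ.
have [->|mi0] := posnP (m i); first by rewrite scale0r rpred0.
apply: rpredZ; rewrite mpoly.dhomogX -(hp m pm) /=; apply/eqP.
have {2}-> : m = mpoly.mnm_add (mpoly.mnm1 i) (mpoly.mnm_sub m (mpoly.mnm1 i)).
  apply/mpoly.mnmP => k; rewrite mpoly.mnmDE mpoly.mnmBE mpoly.mnm1E.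
  by case: eqVneq => [<-|_] /=; rewrite ?subn0// subnKC.
by rewrite mpoly.mdegD mpoly.mdeg1.
Qed.

Lemma homog_mX i : homogeneous 1 (mX i : mp).
Proof.
by rewrite /homogeneous mpoly.dhomogX /= mpoly.mdeg1.
Qed.

Lemma homog_lin x : homogeneous 1 (lin x).
Proof.
apply: rpred_sum => i _; apply: rpredZ; exact: homog_mX.
Qed.

Lemma homogM l n p q : homogeneous l p -> homogeneous n q -> homogeneous (l + n) (p * q).
Proof. exact: mpoly.dhomogM. Qed.

Lemma homog_linX x n : homogeneous n (lin x ^+ n).
Proof. by rewrite -[n in homogeneous n]mul1n; apply: mpoly.dhomogMn; exact: homog_lin. Qed.

Lemma euler l p : homogeneous l p -> \sum_i mX i * D i p = l%:R *: p.
Proof.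
move=> /mpoly.dhomogP hp; rewrite [p]mpoly.mpolyE.
under eq_bigr do rewrite (raddf_sum (D _)) mulr_sumr.
rewrite exchange_big scaler_sumr /=; apply: eq_big_seq => m mp.
under eq_bigr do rewrite mpoly.mderivZ -scalerAr mX_D_monomial scalerA mulrC -scalerA.
by rewrite -scaler_suml -natr_sum -mpoly.mdegE (hp m mp) .
Qed.

Lemma ev_euler l p x : homogeneous l p -> \sum_i x i 0 * ev x (D i p) = l%:R * ev x p.
Proof.
move=> /euler/(congr1 (ev x)); rewrite evZ ev_sum => <-.
by apply: eq_bigr => i _; rewrite evM evX.
Qed.

Lemma laplacian_linear : linear (@mpoly_laplacian R).
Proof.
move=> c p q; rewrite /mpoly_laplacian scaler_sumr -big_split/=.
by apply: eq_bigr => i _; rewrite !mpoly.mderivD !mpoly.mderivZ.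
Qed.

HB.instance Definition _ := GRing.isLinear.Build R mp mp *:%R
  (@mpoly_laplacian R) laplacian_linear.

Lemma harmonicD l p q : harmonic l p -> harmonic l q -> harmonic l (p + q).
Proof.
move=> [hp lp] [hq lq]; split; first exact: rpredD.
by rewrite raddfD /= lp lq addr0.
Qed.

Lemma harmonicZ l (c : R) p : harmonic l p -> harmonic l (c *: p).
Proof.
by move=> [hp lp]; split; [exact: rpredZ|rewrite linearZ /= lp scaler0].
Qed.

Lemma harmonic0 l : harmonic l 0.
Proof. by split; [exact: rpred0|exact: raddf0]. Qed.

Lemma harmonic_D i l p : harmonic l p -> harmonic l.-1 (D i p).
Proof.
move=> [hp lp]; split; first exact: homog_D.
have : D i (mpoly_laplacian p) = 0 by rewrite lp raddf0.
rewrite /mpoly_laplacian (raddf_sum (D i)) => {2}<-; apply: eq_bigr => j _ /=.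
by rewrite (mpoly.mderiv_comm _ j) (mpoly.mderiv_comm _ j (D j p)).
Qed.

Lemma homog0_const p : homogeneous 0 p -> exists c : R, p = c%:A.
Proof.
move=> /mpoly.dhomogP hp; exists (mpoly.mcoeff mpoly.mnm0 p).
apply/mpoly.mpolyP => m; rewrite mpoly.mcoeffZ -mpoly.mpolyX0 mpoly.mcoeffX.
have [<-|m0] := eqVneq mpoly.mnm0 m; first by rewrite mulr1.
rewrite mulr0; apply/eqP; rewrite mpoly.mcoeff_eq0; apply: contra m0 => /hp /= m0.
by rewrite eq_sym -mpoly.mdeg_eq0 m0.
Qed.

(* [fh l N] is the eigenvalue of the kernel (x . y) ^ N on harmonics of degree l. *)
Fixpoint fh_moment N : R :=
  match N with
  | 0%N => SI 1
  | 1%N => 0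
  | N'.+2 => N'.+1%:R / N'.+3%:R * fh_moment N'
  end.

Fixpoint fh l N : R :=
  if l is l'.+1 then N%:R / (N + l').+2%:R * fh l' N.-1 else fh_moment N.

Lemma SI_X_linX i x N l p : homogeneous l p ->
  (N + l).+2%:R * SI (mX i * (lin x ^+ N * p)) =
  N%:R * x i 0 * SI (lin x ^+ N.-1 * p) + SI (lin x ^+ N * D i p).
Proof.
move=> hp; rewrite (SI_X _ (homogM (homog_linX x N) hp)).
by rewrite mpoly.mderivM D_linX SID -scalerAl SIZ.
Qed.

(** One factor x.y is expanded as the sum of the x_i y_i, and the x_i^2 add up to 1. The resulting
    recursion has step two, hence an induction on two consecutive exponents. *)
Lemma SI_linX x N : S2 x -> SI (lin x ^+ N) = fh_moment N.
Proof.
move=> /S2E Sx; have h1 : homogeneous 0 (1 : mp) by exact: mpoly.dhomog1.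
have SE N' : N'.+2%:R * SI (lin x ^+ N'.+1) = N'%:R * SI (lin x ^+ N'.-1).
  rewrite exprS {1}/lin mulr_suml raddf_sum mulr_sumr /=.
  transitivity (\sum_i x i 0 * x i 0 * (N'%:R * SI (lin x ^+ N'.-1))).
    apply: eq_bigr => i _; rewrite -scalerAl SIZ mulrCA -[lin x ^+ N']mulr1.
    have := SI_X_linX i x N' h1; rewrite addn0 => ->.
    by rewrite D1 !mulr0 raddf0 addr0 mulr1; ring.
  by rewrite -mulr_suml -dotE Sx mul1r.
have H n : SI (lin x ^+ n) = fh_moment n /\ SI (lin x ^+ n.+1) = fh_moment n.+1.
  elim: n => [|n [IH0 IH1]].
    split; first by rewrite expr0.
    have /eqP := SE 0%N; rewrite mul0r mulf_eq0 pnatr_eq0 => /eqP -> //.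
  split=> //; apply: (mulfI (_ : n.+3%:R != 0)); first by rewrite pnatr_eq0.
  by rewrite SE IH0 [fh_moment _]/= mulrA mulrCA divff ?mulr1// pnatr_eq0.
by case: (H N).
Qed.

Lemma funk_hecke x N l p : S2 x -> harmonic l p ->
  SI (lin x ^+ N * p) = fh l N * ev x p.
Proof.
move=> Sx; elim: l N p => [|l IHl] N p hp.
  have [c ->] := homog0_const hp.1.
  by rewrite -scalerAr mulr1 SIZ SI_linX// evZ ev1 mulr1 mulrC.
have l0 : (l.+1%:R : R) != 0 by rewrite pnatr_eq0.
have Nl0 : ((N + l).+2%:R : R) != 0 by rewrite pnatr_eq0.
apply: (mulfI l0); apply: (mulfI Nl0).
have -> : l.+1%:R * SI (lin x ^+ N * p) = \sum_i SI (mX i * (lin x ^+ N * D i p)).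
  rewrite -SIZ scalerAr -(euler hp.1) mulr_sumr raddf_sum /=.
  by apply: eq_bigr => i _; rewrite mulrCA.
rewrite mulr_sumr.
under eq_bigr do rewrite (SI_X_linX _ _ _ (homog_D _ hp.1)) (IHl _ _ (harmonic_D _ hp)).
(* The terms with D_i D_i p add up to the Laplacian of p, which is zero. In the others, Euler's
   identity at x reassembles p(x) from its partial derivatives. *)
rewrite big_split/= [X in _ + X](_ : _ = 0) ?addr0; last first.
  rewrite -raddf_sum -mulr_sumr /= -/(mpoly_laplacian p) hp.2 mulr0 raddf0 //.
transitivity (N%:R * fh l N.-1 * (l.+1%:R * ev x p)).
  rewrite -(ev_euler x hp.1) mulr_sumr; apply: eq_bigr => i _; ring.
by rewrite [fh _ _]/=; field.
Qed.

Lemma SI_X_funk_hecke j x N l p : S2 x -> harmonic l p ->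
  (N + l).+2%:R * SI (mX j * (lin x ^+ N * p)) =
  N%:R * fh l N.-1 * ev x p * x j 0 + fh l.-1 N * ev x (D j p).
Proof.
move=> Sx hp; rewrite (SI_X_linX _ _ _ hp.1) (funk_hecke _ Sx hp).
by rewrite (funk_hecke _ Sx (harmonic_D j hp)); ring.
Qed.

End funk_hecke.

(** * Integrals of W for polynomial kernels *)

Section kernel_polynomials.
Context {R : realType}.
Local Notation cV := 'cV[R]_3.
Local Notation mp := (mpoly.mpoly 3 R).
Local Notation D := mpoly.mderiv.
Implicit Types (x y : cV) (p : mp) (q : {poly R}) (i j k : 'I_3) (l n : nat).

Definition rot_op k p : mp := mX (k + 1) * D (k + 2) p - mX (k + 2) * D (k + 1) p.

(** On the sphere this is the tangential projection of grad p, for p homogeneous of degree l: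
    Euler's identity replaces y.grad p by l p. Its two terms have different degrees and are
    integrated separately. *)
Definition sgrad_op l k p : mp := D k p - l%:R *: (mX k * p).

(* As a polynomial in y, the j-th coordinate of q'(x.y) (x.G) y + q(x.y) G. *)
Definition wave_poly q x (G : 'I_3 -> mp) j : mp :=
  horner_alg (lin x) q^`() * (mX j * \sum_k x k 0 *: G k) + horner_alg (lin x) q * G j.

Lemma horner_alg_lin_linear x (c : R) q1 q2 :
  horner_alg (lin x) (c *: q1 + q2) =
  c *: horner_alg (lin x) q1 + horner_alg (lin x) q2.
Proof. by apply: (etrans (linearP (horner_alg (lin x)) c q1 q2)); rewrite /= mulr_algl. Qed.

Lemma wave_poly_linear x (G : 'I_3 -> mp) j (c : R) q1 q2 :
  wave_poly (c *: q1 + q2) x G j = c *: wave_poly q1 x G j + wave_poly q2 x G j.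
Proof.
rewrite /wave_poly derivD derivZ !horner_alg_lin_linear !mulrDl -!scalerAl scalerDr.
exact: addrACA.
Qed.

Lemma wave_polyXn x (G : 'I_3 -> mp) j n : wave_poly 'X^n x G j =
  n%:R *: (mX j * (lin x ^+ n.-1 * \sum_k x k 0 *: G k)) + lin x ^+ n * G j.
Proof.
rewrite /wave_poly derivXn raddfMn /= !rmorphXn /= !horner_algX.
by rewrite -scaler_nat -scalerAl [X in _ *: X + _]mulrCA.
Qed.

Lemma poly_span (P : {poly R} -> Prop) :
  (forall c q1 q2, P q1 -> P q2 -> P (c *: q1 + q2)) -> (forall n, P 'X^n) ->
  forall q, P q.
Proof.
move=> PD PX q; have P0 : P 0.
  by rewrite -(addNr ('X^0)) -scaleN1r; apply: PD.
rewrite -[q]coefK poly_def; apply: big_ind => //.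
  by move=> q1 q2 P1 P2; rewrite -(scale1r q1); exact: PD.
by move=> i _; rewrite -[_ *: _]addr0; exact: PD.
Qed.

Lemma D_mX_mul i j p : D i (mX j * p) = (i == j)%:R *: p + mX j * D i p.
Proof. by rewrite mpoly.mderivM D_mX scaler_nat mulr_natl. Qed.

Lemma laplacian_mX_mul i p :
  mpoly_laplacian (mX i * p) = D i p *+ 2 + mX i * mpoly_laplacian p.
Proof.
rewrite /mpoly_laplacian mulr_sumr.
transitivity (\sum_j (((j == i)%:R *: D j p) *+ 2 + mX i * D j (D j p))).
  apply: eq_bigr => j _.
  by rewrite D_mX_mul mpoly.mderivD mpoly.mderivZ D_mX_mul addrA mulr2n.
rewrite big_split/= sumrMnl; congr (_ *+ 2 + _).
rewrite (bigD1 i)//= eqxx scale1r big1 ?addr0// => j /negbTE ->.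
by rewrite scale0r.
Qed.

(** The Laplacian of y_i D_j p is 2 D_i D_j p, which is symmetric in i and j and cancels in the
    difference. Degree 0 is apart since the truncated l.-1 + 1 is not l there. *)
Lemma harmonic_rot_op k l p : harmonic l p -> harmonic l (rot_op k p).
Proof.
case: l => [|l] hp.
  have [c ->] := homog0_const hp.1; rewrite /rot_op !mpoly.mderivZ !D1 !scaler0 !mulr0 subr0.
  exact: harmonic0.
split.
  by apply: rpredB; apply: (homogM (homog_mX _) (homog_D _ hp.1)).
rewrite /rot_op raddfB /= !laplacian_mX_mul.
rewrite (harmonic_D _ hp).2 (harmonic_D (k+1) hp).2 !mulr0 !addr0.
by rewrite mpoly.mderiv_comm subrr.
Qed.



Lemma harmonic_sum l (F : 'I_3 -> mp) : (forall k, harmonic l (F k)) ->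
  harmonic l (\sum_k F k).
Proof.
by move=> hF; apply: (big_ind (harmonic l)) => //;
  [exact: harmonic0|move=> p q; exact: harmonicD].
Qed.

Lemma ev_rot_op x k p :
  ev x (rot_op k p) = x (k + 1) 0 * ev x (D (k + 2) p) - x (k + 2) 0 * ev x (D (k + 1) p).
Proof. by rewrite evB !evM !evX. Qed.

Lemma ord3_cases (P : 'I_3 -> Prop) : P 0 -> P 1 -> P 2 -> forall k, P k.
Proof.
by move=> P0 P1 P2 [[|[|[|//]]] k3]; [move: P0|move: P1|move: P2];
  congr (P _); exact/val_inj.
Qed.

Lemma ev_D_rot_op x j k p : ev x (D j (rot_op k p)) =
  (j == k + 1)%:R * ev x (D (k + 2) p) + x (k + 1) 0 * ev x (D (k + 2) (D j p)) -
  ((j == k + 2)%:R * ev x (D (k + 1) p) + x (k + 2) 0 * ev x (D (k + 1) (D j p))).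
Proof.
rewrite mpoly.mderivB !D_mX_mul evB !evD !evZ !evM !evX.
by rewrite !(mpoly.mderiv_comm _ j).
Qed.

Lemma ord3E : ((0 + 1 = 1 :> 'I_3) * (0 + 2 = 2 :> 'I_3) * (1 + 1 = 2 :> 'I_3) *
  (1 + 2 = 0 :> 'I_3) * (2 + 1 = 0 :> 'I_3) * (2 + 2 = 1 :> 'I_3)) *
  (((0 == 1 :> 'I_3) = false) * ((0 == 2 :> 'I_3) = false) * ((1 == 0 :> 'I_3) = false) *
  ((1 == 2 :> 'I_3) = false) * ((2 == 0 :> 'I_3) = false) * ((2 == 1 :> 'I_3) = false)).
Proof. by do !split; exact/val_inj. Qed.

(** Meant for v = x, d = grad p(x) and e = grad (D_j p)(x). The terms in e form the triple product
    of v, v and e, which is zero; only those that come from differentiating a coordinate survive. *)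
Lemma rot_contraction (v d e : 'I_3 -> R) j :
  \sum_k v k * ((j == k + 1)%:R * d (k + 2) + v (k + 1) * e (k + 2) -
                ((j == k + 2)%:R * d (k + 1) + v (k + 2) * e (k + 1))) =
  - (v (j + 1) * d (j + 2) - v (j + 2) * d (j + 1)).
Proof.
rewrite sum3; move: j; apply: ord3_cases; rewrite !ord3E !eqxx /=;
  move: (v 0) (v 1) (v 2) (d 0) (d 1) (d 2) (e 0) (e 1) (e 2) =>
  v0 v1 v2 d0 d1 d2 e0 e1 e2; ring.
Qed.

(** In the sum, x is a constant for [D j]; it is only afterwards that the result is evaluated at
    this same x. *)
Lemma ev_D_rot_sum x j p :
  ev x (D j (\sum_k x k 0 *: rot_op k p)) = - ev x (rot_op j p).
Proof.
rewrite (raddf_sum (D j)) ev_sum ev_rot_op.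
rewrite -(rot_contraction (fun k => x k 0) (fun k => ev x (D k p))
  (fun k => ev x (D k (D j p)))).
by apply: eq_bigr => k _; rewrite /= mpoly.mderivZ evZ ev_D_rot_op.
Qed.

Lemma ev_rot_sum x p : ev x (\sum_k x k 0 *: rot_op k p) = 0.
Proof.
rewrite ev_sum sum3 !evZ !ev_rot_op !ord3E.
move: (ev x (D 0 p)) (ev x (D 1 p)) (ev x (D 2 p)) => d0 d1 d2.
move: (x 0 0) (x 1 0) (x 2 0) => x0 x1 x2; ring.
Qed.

Lemma fhS l n : (1 <= l)%N ->
  (n + l).+1%:R * fh l n = n%:R * fh l.-1 n.-1 :> R.
Proof.
case: l => // l _; rewrite addnS /=.
by field.
Qed.

(** Let Q(y) = x.(L_* p)(y). It is harmonic of degree l, with Q(x) = 0 and D_j Q(x) = - (L_*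
    p)_j(x). For q = t^n, both terms of W thus give multiples of (L_* p)_j(x), and the recursion of
    [fh] in both indices makes them cancel. *)
Lemma SI_wave_rot l q x j p : (1 <= l)%N -> S2 x -> harmonic l p ->
  SI (wave_poly q x (rot_op ^~ p) j) = 0.
Proof.
move=> l1 Sx hp; elim/poly_span: q => [c q1 q2 h1 h2|n].
  by rewrite wave_poly_linear SID SIZ h1 h2 mulr0 addr0.
rewrite wave_polyXn SID SIZ.
rewrite (funk_hecke _ Sx (harmonic_rot_op j hp)).
have hQ : harmonic l (\sum_k x k 0 *: rot_op k p).
  by apply: harmonic_sum => k; apply: harmonicZ; exact: harmonic_rot_op.
have := SI_X_funk_hecke j n.-1 Sx hQ.
rewrite ev_rot_sum ev_D_rot_sum mulr0 mul0r add0r.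
(* For n = 0 the first term has the factor 0, and the second one vanishes because [fh l 0] is 0 for
   l >= 1. *)
case: n => [|n] H.
  by rewrite !mul0r add0r; case: l l1 {hp hQ H} => //= l _; rewrite !mul0r.
have n0 : ((n + l).+2%:R : R) != 0 by rewrite pnatr_eq0.
apply: (mulfI n0); rewrite mulr0 mulrDr mulrCA [X in n.+1%:R * X]H.
have := fhS n.+1 l1; rewrite addSn /= => fE; rewrite [X in _ + X]mulrA fE; ring.
Qed.

(** The constants are chosen before x, j and p. Their independence of p is what makes the multiplier
    simple in the end. *)
Lemma SI_wave_grad l q : (1 <= l)%N -> exists a b : R,
  forall x j p, S2 x -> harmonic l p ->
  SI (wave_poly q x (sgrad_op l ^~ p) j) = a * ev x p * x j 0 + b * ev x (D j p).
Proof.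
move=> l1; elim/poly_span: q => [c q1 q2 [a1 [b1 h1]] [a2 [b2 h2]]|n].
  exists (c * a1 + a2), (c * b1 + b2) => x j p Sx hp.
  by rewrite wave_poly_linear SID SIZ h1// h2//; ring.
(* Let Q(y) = x.grad p(y), harmonic of degree l - 1. The factor [e] comes from integrating n y_j
   (x.y)^(n-1) Q. In [g], the n + 1 counts n terms l y_j (x.y)^n p from the factor x.g of W and one
   more from its summand kappa g. *)
pose e : R := n%:R / (n + l)%:R; pose g : R := l%:R * n.+1%:R / (n + l).+2%:R.
exists (e * n.-1%:R * fh l.-1 n.-2 * l%:R - g * n%:R * fh l n.-1),
  (e * l.-1%:R * fh l.-2 n.-1 - g * fh l.-1 n + fh l.-1 n) => x j p Sx hp.
rewrite wave_polyXn SID SIZ.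
pose Q := \sum_k x k 0 *: D k p.
have hQ : harmonic l.-1 Q.
  by apply: harmonic_sum => k; apply: harmonicZ; exact: harmonic_D.
have GQ : \sum_k x k 0 *: sgrad_op l k p = Q - l%:R *: (lin x * p).
  rewrite /sgrad_op /Q /lin; under eq_bigr do rewrite scalerBr.
  rewrite sumrB mulr_suml scaler_sumr; congr (_ - _).
  by apply: eq_bigr => k _; rewrite -scalerAl !scalerA mulrC.
have evQ : ev x Q = l%:R * ev x p.
  by rewrite -(ev_euler x hp.1) ev_sum; apply: eq_bigr => k _; rewrite evZ.
have evDQ : ev x (D j Q) = l.-1%:R * ev x (D j p).
  rewrite -(ev_euler x (homog_D j hp.1)) (raddf_sum (D j)) ev_sum.
  by apply: eq_bigr => k _; rewrite /= mpoly.mderivZ evZ mpoly.mderiv_comm.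
have S2E : n%:R * SI (mX j * (lin x ^+ n.-1 * (Q - l%:R *: (lin x * p)))) =
    n%:R * SI (mX j * (lin x ^+ n.-1 * Q)) -
    l%:R * n%:R * SI (mX j * (lin x ^+ n * p)).
  case: n {e g} => [|n]; first by rewrite mulr0 !mul0r subrr.
  have E : lin x ^+ n * (lin x * p) = lin x ^+ n.+1 * p by rewrite mulrA -exprSr.
  rewrite succnK (mulrBr (lin x ^+ n)) -scalerAr E (mulrBr (mX j)) -scalerAr.
  by rewrite raddfB /= SIZ mulrBr; congr (_ - _); rewrite mulrCA mulrA.
have S1E : n%:R * SI (mX j * (lin x ^+ n.-1 * Q)) =
    e * (n.-1%:R * fh l.-1 n.-2 * ev x Q * x j 0 + fh l.-2 n.-1 * ev x (D j Q)).
  rewrite /e; have := SI_X_funk_hecke j n.-1 Sx hQ.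
  case: n {e g S2E} => [|n]; first by rewrite !mul0r.
  case: l l1 {hp hQ GQ evQ evDQ} => // l' _; rewrite !succnK => <-.
  by rewrite addSn addnS [RHS]mulrA divfK// pnatr_eq0.
have S3E : SI (mX j * (lin x ^+ n * p)) = (n + l).+2%:R^-1 *
    (n%:R * fh l n.-1 * ev x p * x j 0 + fh l.-1 n * ev x (D j p)).
  rewrite -(SI_X_funk_hecke j n Sx hp) mulKf// pnatr_eq0//.
rewrite GQ S2E S1E /sgrad_op mulrBr raddfB /= (funk_hecke _ Sx (harmonic_D j hp)).
rewrite -scalerAr SIZ [lin x ^+ n * (mX j * p)]mulrCA S3E evQ evDQ /g -natr1; ring.
Qed.

End kernel_polynomials.

(** * Surface gradient and curl of polynomials *)

Section derivatives_of_polynomials.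
Context {R : realType}.
Local Notation cV := 'cV[R]_3.
Local Notation mp := (mpoly.mpoly 3 R).
Local Notation D := mpoly.mderiv.
Implicit Types (x y v : cV) (p : mp) (i j k : 'I_3).

Lemma is_derive_coord j x v : is_derive x v (fun y : cV => y j 0) (v j 0).
Proof.
have E : (fun h : R => h^-1 *: ((h *: v + x) j 0 - x j 0)) @ 0^' --> v j 0.
  apply: (@cvg_trans _ (cst (v j 0) @ 0^')); last exact: cvg_cst.
  apply: near_eq_cvg; near=> h.
  have h0 : h != 0 by near: h; exact: nbhs_dnbhs_neq.
  by rewrite !mxE addrK /= -[_ *: _]/(_ * _) mulKf.
by apply: DeriveDef; [apply: cvgP E|exact: cvg_lim E].
Unshelve. all: by end_near. Qed.

Lemma is_derive_monomial x i (m : mpoly.multinom 3) :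
  is_derive x (delta_mx i 0) (ev ^~ (mpoly.mpolyX R m)) (ev x (D i (mpoly.mpolyX R m))).
Proof.
pose c j : cV -> R := fun y => y j 0.
have d j : is_derive x (delta_mx i 0) (c j ^+ m j) _ :=
  is_deriveX (m j) (is_derive_coord j x (delta_mx i 0)).
have -> : (ev ^~ (mpoly.mpolyX R m)) = c 0 ^+ m 0 * c 1 ^+ m 1 * c 2 ^+ m 2.
  by apply/funext => y; rewrite ev_monomial !exprfctE.
apply: (is_derive_eq (is_deriveM (is_deriveM (d 0) (d 1)) (d 2))).
rewrite mpoly.mderivX evZ ev_monomial !mpoly.mnmBE !mpoly.mnm1E !mxE !exprfctE -![_ *: _]/(_ * _).
rewrite /c /= eqxx !andbT mulrfctE {c d}.
move: (x 0 0) (x 1 0) (x 2 0) => x0 x1 x2.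
move: i; apply: ord3_cases; rewrite !ord3E !eqxx ?subn1 ?subn0.
- move: (m 0) => a.
  by move: (x0 ^+ a) (x0 ^+ a.-1) (x1 ^+ _) (x2 ^+ _) (x1 ^+ _) (x2 ^+ _) => * /=; ring.
- move: (m 1) => a.
  by move: (x1 ^+ a) (x1 ^+ a.-1) (x0 ^+ _) (x2 ^+ _) (x0 ^+ _) (x2 ^+ _) => * /=; ring.
- move: (m 2) => a.
  by move: (x2 ^+ a) (x2 ^+ a.-1) (x0 ^+ _) (x1 ^+ _) (x0 ^+ _) (x1 ^+ _) => * /=; ring.
Qed.

Lemma is_derive_ev x i p : is_derive x (delta_mx i 0) (ev ^~ p) (ev x (D i p)).
Proof.
elim/mpoly.mpolyind: p => [|c m p _ _ hp].
  rewrite raddf0 ev0 (_ : ev ^~ 0 = cst 0); last by apply/funext => y; rewrite ev0.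
  exact: is_derive_cst.
have -> : (ev ^~ (c *: mpoly.mpolyX R m + p)) = c \*: (ev ^~ (mpoly.mpolyX R m)) + ev ^~ p.
  by apply/funext => y; rewrite evD evZ.
rewrite mpoly.mderivD mpoly.mderivZ evD evZ.
exact: (is_deriveD (is_deriveZ c (is_derive_monomial x i m)) hp).
Qed.

Lemma grad_ev p x : grad (ev ^~ p) x = \col_i ev x (D i p).
Proof.
by apply/colP => i; rewrite !mxE; case: (is_derive_ev x i p).
Qed.

Lemma surface_curl_ev p x i : surface_curl (ev ^~ p) x i 0 = ev x (rot_op i p).
Proof. by rewrite /surface_curl /cross mxE grad_ev !mxE ev_rot_op. Qed.

Lemma surface_grad_ev l p x i : S2 x -> homogeneous l p ->
  surface_grad (ev ^~ p) x i 0 = ev x (sgrad_op l i p).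
Proof.
move=> Sx hp; rewrite /surface_grad mulmxBl mul1mx -mulmxA mxE mxE grad_ev.
rewrite !mxE big_ord1 !mxE evB evZ evM evX mulrCA.
congr (_ - _ * _); first by case: (is_derive_ev x i p).
by rewrite -(ev_euler x hp); apply: eq_bigr => k _; rewrite !mxE.
Qed.

End derivatives_of_polynomials.

(** * Polynomial kernels *)

Section kernel_algebra.
Context {R : realType}.
Local Notation mu := (surface_measure R).
Local Notation cV := 'cV[R]_3.
Local Notation mp := (mpoly.mpoly 3 R).
Local Notation D := mpoly.mderiv.
Implicit Types (k dk : R -> R) (x y f : cV) (p : mp) (q : {poly R}) (i j : 'I_3) (l : nat).

Definition kern k dk x y : 'M[R]_3 := let t := dot x y in
  ((- dk t) *: (cross x y *m (cross x y)^T) + k t *: (t%:M - y *m x^T)) +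
  (dk t *: ((y - t *: x) *m (x - t *: y)^T)
   + k t *: ((1%:M - x *m x^T) *m (1%:M - y *m y^T))).

Lemma mulmx_cV1 (u v : cV) i j : (u *m v^T) i j = u i 0 * v j 0.
Proof. by rewrite mxE big_ord1 mxE. Qed.

Lemma kernE k dk x y i j : kern k dk x y i j =
  - dk (dot x y) * (cross x y i 0 * cross x y j 0) +
  k (dot x y) * (dot x y *+ (i == j) - y i 0 * x j 0) +
  (dk (dot x y) * ((y i 0 - dot x y * x i 0) * (x j 0 - dot x y * y j 0)) +
   k (dot x y) * ((i == j)%:R - x i 0 * x j 0 - y i 0 * y j 0 +
                  dot x y * (x i 0 * y j 0))).
Proof.
rewrite /kern; set t := dot x y.
have -> : (1%:M - x *m x^T) *m (1%:M - y *m y^T) =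
    1%:M - x *m x^T - y *m y^T + t *: (x *m y^T).
  rewrite mulmxBl mul1mx mulmxBr mulmx1 -mulmxA [x^T *m _]mulmxA.
  rewrite [x^T *m y]mx11_scalar -/(dot x y) -/t mul_scalar_mx -scalemxAr.
  by rewrite opprD opprK addrA [_ - y *m y^T - _]addrAC.
have S (M N : 'M[R]_3) : (M + N) i j = M i j + N i j by rewrite mxE.
have SN (M : 'M[R]_3) : (- M) i j = - M i j by rewrite mxE.
have SZ a (M : 'M[R]_3) : (a *: M) i j = a * M i j by rewrite mxE.
rewrite !(S, SN, SZ) !mulmx_cV1 ![(_%:M : 'M[R]_3) i j]mxE.
have SC (u v : cV) n : (u - t *: v) n 0 = u n 0 - t * v n 0 by rewrite !mxE.
by rewrite !SC.
Qed.

Lemma dotC x y : dot x y = dot y x.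
Proof. by rewrite !dotE3; ring. Qed.

Lemma cross_norm x y : S2 x -> S2 y ->
  \sum_i cross x y i 0 ^+ 2 = 1 - dot x y ^+ 2.
Proof.
move=> /S2E + /S2E; rewrite sum3 !dotE3 !mxE !ord3E.
move: (x 0 0) (x 1 0) (x 2 0) (y 0 0) (y 1 0) (y 2 0) => a b c d e f h1 h2.
transitivity ((a * a + b * b + c * c) * (d * d + e * e + f * f) -
  (a * d + b * e + c * f) ^+ 2).
  by ring.
by rewrite h1 h2 mulr1.
Qed.

Lemma proj_norm x y : S2 x -> S2 y ->
  \sum_i (y i 0 - dot x y * x i 0) ^+ 2 = 1 - dot x y ^+ 2.
Proof.
move=> /S2E Sx /S2E Sy.
have -> : \sum_i (y i 0 - dot x y * x i 0) ^+ 2 =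
    dot y y - (dot x y * dot x y) *+ 2 + dot x y ^+ 2 * dot x x.
  by rewrite sum3 !dotE3; ring.
by rewrite Sx Sy; ring.
Qed.

(** Both coordinates have squares at most s, and |a b| <= (a^2 + b^2) / 2. *)
Lemma mul_le_of_sqr (I : finType) (u v : I -> R) (s : R) (i j : I) :
  \sum_i u i ^+ 2 = s -> \sum_i v i ^+ 2 = s -> `|u i * v j| <= s.
Proof.
move=> us vs.
have ui : u i ^+ 2 <= s by rewrite -us (bigD1 i)//= lerDl sumr_ge0// => *; exact: sqr_ge0.
have vj : v j ^+ 2 <= s by rewrite -vs (bigD1 j)//= lerDl sumr_ge0// => *; exact: sqr_ge0.
rewrite ler_norml; apply/andP; split; nra.
Qed.

Lemma dot_le1 x y : S2 x -> S2 y -> `|dot x y| <= 1.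
Proof.
move=> Sx Sy; have := proj_norm Sx Sy => E.
have : 0 <= 1 - dot x y ^+ 2 by rewrite -E sumr_ge0// => *; exact: sqr_ge0.
by move=> t1; rewrite ler_norml; apply/andP; split; nra.
Qed.

(** The factor [dk] meets one product of coordinates in each of the two parts, taken from vectors of
    squared length 1 - t^2 (for the cross product, by Lagrange's identity). The 6 counts the 2 + 4
    terms of size at most 1 that multiply [k]. *)
Lemma kern_le k dk x y i j : S2 x -> S2 y ->
  `|kern k dk x y i j| <=
  2 * ((1 - dot x y ^+ 2) * `|dk (dot x y)|) + 6 * `|k (dot x y)|.
Proof.
move=> Sx Sy; rewrite kernE.
have t1 := dot_le1 Sx Sy.
have c1 := mul_le_of_sqr i j (cross_norm Sx Sy) (cross_norm Sx Sy).
have c2 : `|(y i 0 - dot x y * x i 0) * (x j 0 - dot x y * y j 0)| <= 1 - dot x y ^+ 2.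
  have := proj_norm Sy Sx; rewrite [dot y x]dotC => yx.
  exact: (@mul_le_of_sqr _ (fun i => y i 0 - dot x y * x i 0)
    (fun j => x j 0 - dot x y * y j 0) _ i j (proj_norm Sx Sy) yx).
have b (u v : cV) a c : S2 u -> S2 v -> `|u a 0 * v c 0| <= 1.
  by move=> Su Sv; rewrite normrM mulr_ile1// S2_coord_le.
have d1 : `|(i == j)%:R : R| <= 1 by case: (i == j); rewrite ?normr1 ?normr0.
have d2 : `|dot x y *+ (i == j)| <= 1 by case: (i == j); rewrite ?mulr1n// mulr0n normr0.
have c3 : `|dot x y *+ (i == j) - y i 0 * x j 0| <= 2.
  by rewrite (le_trans (ler_normB _ _))// -[2]/(1 + 1) lerD// b.
have c4 : `|(i == j)%:R - x i 0 * x j 0 - y i 0 * y j 0 + dot x y * (x i 0 * y j 0)| <= 4.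
  rewrite (le_trans (ler_normD _ _))// (_ : 4 = 1 + 1 + 1 + 1); last by ring.
  rewrite lerD//; last by rewrite normrM mulr_ile1// b.
  rewrite (le_trans (ler_normB _ _))// lerD ?b//.
  by rewrite (le_trans (ler_normB _ _))// lerD ?b.
move: (_ * cross x y j 0) ((y i 0 - _) * _) (_ - y i 0 * x j 0) (_ + dot x y * _) c1 c2 c3 c4.
move: (dk _) (k _) (1 - _) => a c s A B C E hA hB hC hE.
rewrite (le_trans (ler_normD _ _))//.
have -> : 2 * (s * `|a|) + 6 * `|c| = (s * `|a| + 2 * `|c|) + (s * `|a| + 4 * `|c|) by ring.
by rewrite lerD// (le_trans (ler_normD _ _))// !normrM ?normrN lerD// mulrC ler_wpM2r.
Qed.

(** The vector x is orthogonal to x cross y and to y - t x, it is killed by 1 - x x^T, and x^T (t -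
    y x^T) = t x^T - t x^T. *)
Lemma kern_tangential k dk x y j : S2 x -> \sum_i x i 0 * kern k dk x y i j = 0.
Proof.
move=> /S2E Sx.
have delta : \sum_i x i 0 * (i == j)%:R = x j 0.
  by rewrite (bigD1 j)//= eqxx mulr1 big1 ?addr0// => i /negbTE ->; rewrite mulr0.
have xc : \sum_i x i 0 * cross x y i 0 = 0.
  rewrite sum3 !mxE !ord3E.
  by move: (x 0 0) (x 1 0) (x 2 0) (y 0 0) (y 1 0) (y 2 0) => *; ring.
have xx : \sum_i x i 0 * x i 0 = 1 by rewrite -dotE.
have xy : \sum_i x i 0 * y i 0 = dot x y by rewrite -dotE.
transitivity (- dk (dot x y) * cross x y j 0 * (\sum_i x i 0 * cross x y i 0)
  + k (dot x y) * (dot x y * (\sum_i x i 0 * (i == j)%:R) - x j 0 * (\sum_i x i 0 * y i 0))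
  + dk (dot x y) * (x j 0 - dot x y * y j 0) *
    ((\sum_i x i 0 * y i 0) - dot x y * (\sum_i x i 0 * x i 0))
  + k (dot x y) * ((\sum_i x i 0 * (i == j)%:R) - x j 0 * (\sum_i x i 0 * x i 0)
      - y j 0 * (\sum_i x i 0 * y i 0) + dot x y * y j 0 * (\sum_i x i 0 * x i 0))).
  rewrite !sum3 !kernE -![dot x y *+ _]mulr_natr.
  move: (dk _) (k _) => a c.
  move: (dot x y) (cross x y j 0) (cross x y 0 0) (cross x y 1 0) (cross x y 2 0).
  move: ((0 == j)%:R : R) ((1 == j)%:R : R) ((2 == j)%:R : R).
  move: (x 0 0) (x 1 0) (x 2 0) (y 0 0) (y 1 0) (y 2 0) (x j 0) (y j 0) => *; ring.
by rewrite delta xc xx xy; ring.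
Qed.

Lemma kern_sub k dk h dh x y i j :
  kern (k \- h) (dk \- dh) x y i j = kern k dk x y i j - kern h dh x y i j.
Proof. by rewrite !kernE /=; ring. Qed.

(* The two summands are the contributions of Psi_div and Psi_curl. *)
Lemma kern_tangent_field k dk x y f i : dot y f = 0 -> let t := dot x y in
  let W (g : cV) : cV := dk t *: (dot x g *: y) + k t *: g in
  (kern k dk x y *m f) i 0 =
  cross x (W (cross f y)) i 0 + (W f i 0 - x i 0 * dot x (W f)).
Proof.
move=> yf t W.
have WE g n : W g n 0 = dk t * (dot x g * y n 0) + k t * g n 0 by rewrite !mxE.
rewrite mxE sum3 !kernE -/t.
have -> : cross x (W (cross f y)) i 0 =
  x (i + 1) 0 * W (cross f y) (i + 2) 0 - x (i + 2) 0 * W (cross f y) (i + 1) 0.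
  by rewrite mxE.
rewrite (dotE3 x (W f)) !WE {W WE}.
move: (dk t) (k t) => a c.
move: yf; rewrite /t !dotE3 {t} !mxE.
move: i; apply: ord3_cases; rewrite !ord3E !eqxx !mulr0n !mulr1n;
  move: (x 0 0) (x 1 0) (x 2 0) (y 0 0) (y 1 0) (y 2 0) (f 0 0) (f 1 0) (f 2 0) =>
  x0 x1 x2 y0 y1 y2 f0 f1 f2 yf.
(* In each coordinate the two sides differ by a multiple of y.f, namely - (y.f) (a t + c) (y_i - t
   x_i). *)
- apply/eqP; rewrite -subr_eq0; apply/eqP.
  transitivity (- (y0 * f0 + y1 * f1 + y2 * f2) *
    (a * (x0 * y0 + x1 * y1 + x2 * y2) + c) * (y0 - (x0 * y0 + x1 * y1 + x2 * y2) * x0)).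
    by ring.
  by rewrite yf oppr0 !mul0r.
- apply/eqP; rewrite -subr_eq0; apply/eqP.
  transitivity (- (y0 * f0 + y1 * f1 + y2 * f2) *
    (a * (x0 * y0 + x1 * y1 + x2 * y2) + c) * (y1 - (x0 * y0 + x1 * y1 + x2 * y2) * x1)).
    by ring.
  by rewrite yf oppr0 !mul0r.
- apply/eqP; rewrite -subr_eq0; apply/eqP.
  transitivity (- (y0 * f0 + y1 * f1 + y2 * f2) *
    (a * (x0 * y0 + x1 * y1 + x2 * y2) + c) * (y2 - (x0 * y0 + x1 * y1 + x2 * y2) * x2)).
    by ring.
  by rewrite yf oppr0 !mul0r.
Qed.

Lemma ev_wave_poly q x (G : 'I_3 -> mp) j y :
  ev y (wave_poly q x G j) =
  q^`().[dot x y] * (dot x (\col_n ev y (G n)) * y j 0) + q.[dot x y] * ev y (G j).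
Proof.
have E r : ev y (horner_alg (lin x) r) = r.[dot x y].
  elim/(@poly_span R): r => [c r1 r2 h1 h2|n].
    by rewrite horner_alg_lin_linear evD evZ h1 h2 !hornerE.
  by rewrite rmorphXn/= horner_algX hornerXn /ev rmorphXn /= -/(ev y (lin x)) ev_lin.
rewrite /wave_poly evD !evM !E evX; congr (_ * _ + _); rewrite mulrC; congr (_ * _).
by rewrite ev_sum dotE; apply: eq_bigr => n _; rewrite evZ mxE.
Qed.

Definition kernq q := kern (horner q) (horner q^`()).

(** The families [G2] and [G1] represent F and its cross product with y on the sphere only, which is
    enough to replace the integrand by a single polynomial. *)
Lemma kernq_integral q x i (F : cV -> cV) (G1 G2 : 'I_3 -> mp) : S2 x ->
  (forall y, S2 y -> [/\ dot y (F y) = 0, forall n, F y n 0 = ev y (G2 n) &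
    forall n, cross (F y) y n 0 = ev y (G1 n)]) ->
  \int[mu]_(y in S2) (kernq q x y *m F y) i 0 =
  x (i + 1) 0 * SI (wave_poly q x G1 (i + 2)) -
  x (i + 2) 0 * SI (wave_poly q x G1 (i + 1)) +
  (SI (wave_poly q x G2 i) - x i 0 * \sum_n x n 0 * SI (wave_poly q x G2 n)).
Proof.
move=> Sx HF.
pose M : mp := x (i + 1) 0 *: wave_poly q x G1 (i + 2) -
  x (i + 2) 0 *: wave_poly q x G1 (i + 1) +
  (wave_poly q x G2 i - x i 0 *: \sum_n x n 0 *: wave_poly q x G2 n).
transitivity (SI M); last first.
  rewrite /M SID !(raddfB SI) /= !SIZ (raddf_sum SI) /=.
  by congr (_ + (_ - _ * _)); apply: eq_bigr => n _; rewrite SIZ.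
apply: eq_Rintegral => y; rewrite inE => Sy; have [yF FG2 FG1] := HF y Sy.
rewrite (kern_tangent_field _ _ _ _ yF) /M.
pose W (g : cV) : cV := q^`().[dot x y] *: (dot x g *: y) + q.[dot x y] *: g.
have WE (g : cV) (G : 'I_3 -> mp) n : (forall n, g n 0 = ev y (G n)) ->
    W g n 0 = ev y (wave_poly q x G n).
  move=> gG; rewrite ev_wave_poly !mxE gG; congr (_ * (dot x _ * _) + _).
  by apply/colP => n'; rewrite mxE gG.
rewrite -/(W _) -/(W _) evD !evB !evZ -!(WE _ _ _ FG1) -(WE _ _ _ FG2).
congr (_ + (_ - _ * _)); first by rewrite [LHS]mxE.
by rewrite dotE ev_sum; apply: eq_bigr => n _; rewrite evZ -(WE _ _ _ FG2).
Qed.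

Lemma dot_surface_curl (h : cV -> R) y : dot y (surface_curl h y) = 0.
Proof.
rewrite dotE3 /surface_curl !mxE !ord3E.
by move: (y 0 0) (y 1 0) (y 2 0) ('D__ h y) ('D__ h y) ('D__ h y) => *; ring.
Qed.

Lemma dot_surface_grad (h : cV -> R) y : S2 y -> dot y (surface_grad h y) = 0.
Proof.
move=> /S2E; rewrite /surface_grad /dot mulmxBl mul1mx mulmxBr !mulmxA => Sy.
by rewrite [y^T *m y]mx11_scalar Sy mul1mx subrr mxE.
Qed.

(** For |y| = 1 the double product of y, v and y is v - (y.v) y, here with v = grad p and y.v = l p
    by Euler's identity. *)
Lemma cross_curl_ev l p y n : S2 y -> homogeneous l p ->
  cross (surface_curl (ev ^~ p) y) y n 0 = ev y (sgrad_op l n p).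
Proof.
move=> /S2E + hp; have := ev_euler y hp; rewrite dotE3 sum3.
rewrite mxE !surface_curl_ev !ev_rot_op evB evZ evM evX.
set d := fun n => ev y (D n p); rewrite -![ev y (D _ p)]/(d _).
move: (ev y p) d => e d.
move: n; apply: ord3_cases; rewrite !ord3E;
  move: (y 0 0) (y 1 0) (y 2 0) (d 0) (d 1) (d 2) => y0 y1 y2 d0 d1 d2 E Sy.
- rewrite mulrCA -E -[X in _ = X - _]mul1r -Sy; ring.
- rewrite mulrCA -E -[X in _ = X - _]mul1r -Sy; ring.
- rewrite mulrCA -E -[X in _ = X - _]mul1r -Sy; ring.
Qed.

Lemma cross_grad_ev l p y n : S2 y -> homogeneous l p ->
  cross (surface_grad (ev ^~ p) y) y n 0 = ev y (rot_op n (- p)).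
Proof.
move=> Sy hp; rewrite mxE !(surface_grad_ev _ Sy hp) ev_rot_op !mpoly.mderivN.
rewrite !evB !evZ !evM !evX /ev !mpoly.mevalN -/(ev y _) -/(ev y _) -/(ev y _).
move: (ev y p) (ev y (D (n + 1) p)) (ev y (D (n + 2) p)) (y (n + 1) 0) (y (n + 2) 0).
by move=> *; ring.
Qed.

(** One factor [b] serves both families because the cross product with y exchanges them up to sign:
    for L_* p only the div part contributes, for nabla_* p only the curl part, and in both cases
    through the same integral of W(nabla_* p). *)
Lemma kernq_eigen l q : (1 <= l)%N -> exists b : R, forall x i p, S2 x -> harmonic l p ->
  \int[mu]_(y in S2) (kernq q x y *m surface_curl (ev ^~ p) y) i 0 =
    b * surface_curl (ev ^~ p) x i 0 /\
  \int[mu]_(y in S2) (kernq q x y *m surface_grad (ev ^~ p) y) i 0 =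
    b * surface_grad (ev ^~ p) x i 0.
Proof.
move=> l1; have [a [b Hab]] := SI_wave_grad q l1; exists b => x i p Sx hp.
have hNp : harmonic l (- p) by rewrite -scaleN1r; exact: harmonicZ.
split.
  rewrite (@kernq_integral _ _ _ _ (sgrad_op l ^~ p) (rot_op ^~ p))//; last first.
    move=> y Sy; split.
    - exact: dot_surface_curl.
    - by move=> n; exact: surface_curl_ev.
    - by move=> n; exact: (cross_curl_ev _ Sy hp.1).
  have := fun j => SI_wave_rot q j l1 Sx hp; have := fun j => Hab x j p Sx hp.
  rewrite surface_curl_ev ev_rot_op.
  move: (sgrad_op l ^~ p) (rot_op ^~ p) => G1 G2 E1 E2.
  rewrite !E1 !E2 big1 => [|n _]; last by rewrite E2 mulr0.
  move: (ev x p) (ev x (D _ p)) (ev x (D _ p)) (x _ 0) (x (i + 1) 0) (x (i + 2) 0).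
  by move=> *; ring.
rewrite (@kernq_integral _ _ _ _ (rot_op ^~ (- p)) (sgrad_op l ^~ p))//; last first.
  move=> y Sy; split.
  - exact: dot_surface_grad.
  - by move=> n; exact: (surface_grad_ev _ Sy hp.1).
  - by move=> n; exact: (cross_grad_ev _ Sy hp.1).
have := fun j => SI_wave_rot q j l1 Sx hNp; have := fun j => Hab x j p Sx hp.
rewrite (surface_grad_ev _ Sx hp.1) /sgrad_op evB evZ evM evX -/(sgrad_op _).
move: (sgrad_op l ^~ p) (rot_op ^~ (- p)) => G2 G1 E2 E1.
rewrite !E1 E2; under eq_bigr do rewrite E2.
have -> : \sum_n x n 0 * (a * ev x p * x n 0 + b * ev x (D n p)) =
    a * ev x p * dot x x + b * (l%:R * ev x p).
  rewrite -(ev_euler x hp.1) dotE !mulr_sumr -big_split; apply: eq_bigr => n _ /=.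
  by ring.
have /S2E -> := Sx.
by move: (ev x p) (ev x (D i p)) (x _ 0) => *; ring.
Qed.

End kernel_algebra.

(** * Passage to the limit *)

Section integral_operators.
Context {R : realType}.
Local Notation mu := (surface_measure R).
Local Notation cV := 'cV[R]_3.
Implicit Types (x y : cV) (F : cV -> cV) (G f : cV -> R) (q : {poly R}) (i j : 'I_3)
  (K : cV -> cV -> R).

Let mS : measurable (@S2 R) := measurable_S2.

Definition S2_integrable f := mu.-integrable S2 (EFin \o f).

Lemma S2_integrableD f G : S2_integrable f -> S2_integrable G ->
  S2_integrable (fun y => f y + G y).
Proof. by move=> hf hG; exact: (integrableD mS hf hG). Qed.

Lemma S2_integrableZ (c : R) f : S2_integrable f -> S2_integrable (fun y => c * f y).
Proof. by move=> hf; exact: (integrableZl mS c hf). Qed.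

Lemma S2_integrable_coordM j f : S2_integrable f -> S2_integrable (fun y => y j 0 * f y).
Proof.
move=> hf; apply: (le_integrable mS _ _ hf).
  apply/measurable_EFinP; apply: measurable_funM.
    by apply: measurable_funTS; exact: measurable_coord.
  by apply/measurable_EFinP; case/integrableP : hf.
move=> y Sy /=; rewrite lee_fin normrM ler_piMl// S2_coord_le//.
Qed.

(** Quantifying over every integrable G allows a factor y_j to be absorbed into G. Measurability in
    x then passes to polynomial kernels with no joint measurability and no Fubini argument. *)
Definition measurable_kernel K := forall G, S2_integrable G ->
  (forall x, S2 x -> S2_integrable (fun y => K x y * G y)) /\
  measurable_fun S2 (fun x => \int[mu]_(y in S2) (K x y * G y)).

Lemma measurable_kernel1 : measurable_kernel (fun _ _ => 1).
Proof.
move=> G hG; split=> [x _|]; last exact: measurable_cst.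
by under eq_fun do rewrite mul1r.
Qed.

Lemma measurable_kernelD K1 K2 : measurable_kernel K1 -> measurable_kernel K2 ->
  measurable_kernel (fun x y => K1 x y + K2 x y).
Proof.
move=> h1 h2 G hG; have [i1 m1] := h1 G hG; have [i2 m2] := h2 G hG; split=> [x Sx|].
  under eq_fun do rewrite mulrDl.
  by apply: S2_integrableD; [exact: i1|exact: i2].
apply: (@eq_measurable_fun _ _ _ _ _ (fun x => \int[mu]_(y in S2) (K1 x y * G y) +
    \int[mu]_(y in S2) (K2 x y * G y))) => [x|]; last exact: measurable_funD.
rewrite inE => Sx; rewrite -RintegralD//; [|exact: i1|exact: i2].
by apply: eq_Rintegral => y _; rewrite mulrDl.
Qed.

Lemma measurable_kernelX i K : measurable_kernel K ->
  measurable_kernel (fun x y => x i 0 * K x y).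
Proof.
move=> h G hG; have [iK mK] := h G hG; split=> [x Sx|].
  under eq_fun do rewrite -mulrA.
  by apply: S2_integrableZ; exact: iK.
apply: (@eq_measurable_fun _ _ _ _ _ (fun x => x i 0 * \int[mu]_(y in S2) (K x y * G y))).
  move=> x; rewrite inE => Sx; rewrite -RintegralZl//; last exact: iK.
  by apply: eq_Rintegral => y _; rewrite mulrA.
by apply: measurable_funM => //; apply: measurable_funTS; exact: measurable_coord.
Qed.

Lemma measurable_kernelZ (c : R) K : measurable_kernel K ->
  measurable_kernel (fun x y => c * K x y).
Proof.
move=> h G hG; have [iK mK] := h G hG; split=> [x Sx|].
  under eq_fun do rewrite -mulrA.
  by apply: S2_integrableZ; exact: iK.
apply: (@eq_measurable_fun _ _ _ _ _ (fun x => c * \int[mu]_(y in S2) (K x y * G y))).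
  move=> x; rewrite inE => Sx; rewrite -RintegralZl//; last exact: iK.
  by apply: eq_Rintegral => y _; rewrite mulrA.
by apply: measurable_funM.
Qed.

Lemma measurable_kernelY j K : measurable_kernel K ->
  measurable_kernel (fun x y => y j 0 * K x y).
Proof.
move=> h G hG; have [iK mK] := h _ (S2_integrable_coordM j hG).
have E x : (fun y => y j 0 * K x y * G y) = (fun y => K x y * (y j 0 * G y)).
  by apply/funext => y; rewrite mulrA [K x y * _]mulrC.
split=> [x Sx|]; first by rewrite E; exact: iK.
by apply: eq_measurable_fun mK => x _; rewrite E.
Qed.

(** Being a measurable kernel is not visibly stable under products, whereas multipliers simply
    compose. *)
Definition kernel_multiplier (L : cV -> cV -> R) := forall K, measurable_kernel K ->
  measurable_kernel (fun x y => L x y * K x y).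

Lemma kernel_multiplierD K1 K2 : kernel_multiplier K1 -> kernel_multiplier K2 ->
  kernel_multiplier (fun x y => K1 x y + K2 x y).
Proof.
move=> h1 h2 K hK.
have -> : (fun x y => (K1 x y + K2 x y) * K x y) =
    (fun x y => K1 x y * K x y + K2 x y * K x y).
  by apply/funext => x; apply/funext => y; rewrite mulrDl.
by apply: measurable_kernelD; [exact: h1|exact: h2].
Qed.

Lemma kernel_multiplierM K1 K2 : kernel_multiplier K1 -> kernel_multiplier K2 ->
  kernel_multiplier (fun x y => K1 x y * K2 x y).
Proof.
move=> h1 h2 K hK.
have -> : (fun x y => K1 x y * K2 x y * K x y) = (fun x y => K1 x y * (K2 x y * K x y)).
  by apply/funext => x; apply/funext => y; rewrite mulrA.
exact/h1/h2.
Qed.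

Lemma kernel_multiplierC (c : R) : kernel_multiplier (fun _ _ => c).
Proof. by move=> K; exact: measurable_kernelZ. Qed.

Lemma kernel_multiplierX i : kernel_multiplier (fun x _ => x i 0).
Proof. by move=> K; exact: measurable_kernelX. Qed.

Lemma kernel_multiplierY j : kernel_multiplier (fun _ y => y j 0).
Proof. by move=> K; exact: measurable_kernelY. Qed.

Lemma kernel_multiplierN K : kernel_multiplier K -> kernel_multiplier (fun x y => - K x y).
Proof.
move=> hK; have -> : (fun x y => - K x y) = (fun x y => -1 * K x y).
  by apply/funext => x; apply/funext => y; rewrite mulN1r.
by apply: kernel_multiplierM => //; exact: kernel_multiplierC.
Qed.

Lemma kernel_multiplier_dot : kernel_multiplier (fun x y => dot x y).
Proof.
have -> : (fun x y : cV => dot x y) =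
    (fun x y => x 0 0 * y 0 0 + x 1 0 * y 1 0 + x 2 0 * y 2 0).
  by apply/funext => x; apply/funext => y; rewrite dotE3.
by do !apply: kernel_multiplierD; apply: kernel_multiplierM;
  [exact: kernel_multiplierX|exact: kernel_multiplierY
  |exact: kernel_multiplierX|exact: kernel_multiplierY
  |exact: kernel_multiplierX|exact: kernel_multiplierY].
Qed.

Lemma kernel_multiplier_poly q : kernel_multiplier (fun x y => q.[dot x y]).
Proof.
elim/poly_ind: q => [|q c IHq].
  have -> : (fun x y => (0 : {poly R}).[dot x y]) = (fun x y => 0).
    by apply/funext => x; apply/funext => y; rewrite horner0.
  exact: kernel_multiplierC.
have -> : (fun x y => (q * 'X + c%:P).[dot x y]) = (fun x y => q.[dot x y] * dot x y + c).
  by apply/funext => x; apply/funext => y; rewrite !hornerE.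
apply: kernel_multiplierD; last exact: kernel_multiplierC.
by apply: kernel_multiplierM => //; exact: kernel_multiplier_dot.
Qed.

Lemma measurable_kernq q i j : measurable_kernel (fun x y => kernq q x y i j).
Proof.
have cX n := @kernel_multiplierX n; have cY n := @kernel_multiplierY n.
have cd := kernel_multiplier_dot; have cP := kernel_multiplier_poly.
have cM := kernel_multiplierM; have cD := kernel_multiplierD.
have cN := kernel_multiplierN; have cC := kernel_multiplierC.
have cc n : kernel_multiplier (fun x y => cross x y n 0).
  have -> : (fun x y : cV => cross x y n 0) =
      (fun x y => x (n + 1) 0 * y (n + 2) 0 + - (x (n + 2) 0 * y (n + 1) 0)).
    by apply/funext => x; apply/funext => y; rewrite mxE.
  by apply: cD; [exact: cM|exact/cN/cM].
suff H : kernel_multiplier (fun x y => kernq q x y i j).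
  by have := H _ measurable_kernel1; under eq_fun do under eq_fun do rewrite mulr1.
have -> : (fun x y => kernq q x y i j) = (fun x y =>
  - q^`().[dot x y] * (cross x y i 0 * cross x y j 0) +
  q.[dot x y] * (dot x y * (i == j)%:R + - (y i 0 * x j 0)) +
  (q^`().[dot x y] * ((y i 0 + - (dot x y * x i 0)) * (x j 0 + - (dot x y * y j 0))) +
   q.[dot x y] * ((i == j)%:R + - (x i 0 * x j 0) + - (y i 0 * y j 0) +
                  dot x y * (x i 0 * y j 0)))).
  by apply/funext => x; apply/funext => y; rewrite /kernq kernE mulr_natr.
apply: (cD); first apply: (cD); last apply: (cD).
- by apply: (cM); [exact/cN/cP|exact: cM].
- by apply: (cM); [exact: cP|apply: (cD); [exact: cM|exact/cN/cM]].
- apply: (cM); first exact: cP.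
  by apply: (cM); apply: (cD); [exact: cY|exact/cN/cM|exact: cX|exact/cN/cM].
- apply: (cM); first exact: cP.
  apply: (cD); last by apply: (cM) => //; exact: cM.
  by apply: (cD); [apply: (cD); [exact: cC|exact/cN/cM]|exact/cN/cM].
Qed.

End integral_operators.

(** * The integral operator of Psi as a limit of polynomial ones *)

Section matrix_kernel.
Context {R : realType}.
Local Notation mu := (surface_measure R).
Local Notation cV := 'cV[R]_3.
Variable psi : R -> R.
Implicit Types (x y : cV) (F : cV -> cV) (q : {poly R}) (i j : 'I_3).

Hypothesis Hpsi : forall e : R, 0 < e -> exists q, forall t : R, -1 < t < 1 ->
  `|kappa psi t - q.[t]| <= e /\
  (1 - t ^+ 2) * `|derive1 (kappa psi) t - q^`().[t]| <= e.

Let mS : measurable (@S2 R) := measurable_S2.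

(* Negligible, so that the values of Psi at y = x and y = -x, which are given by
   a limit, play no role. *)
Definition antipodal_pair x : set cV := [set x] `|` [set - x].

Lemma measurable_antipodal_pair x : measurable (antipodal_pair x).
Proof. by apply: measurableU; exact: measurable_cvec1. Qed.

Let mA x : measurable (S2 `\` antipodal_pair x).
Proof. by apply: measurableD => //; exact: measurable_antipodal_pair. Qed.

Lemma antipodal_pair0 x : mu (antipodal_pair x) = 0%E.
Proof.
apply/eqP; rewrite -measure_le0 (le_trans (measureU2 _ _ _))//;
  try exact: measurable_cvec1.
by rewrite /= !surface_measure_set1 adde0.
Qed.

Lemma S2N x : S2 x -> S2 (- x).
Proof. by move=> /S2E Sx; apply/S2E; rewrite -Sx !dotE3 !mxE; ring. Qed.

Lemma antipodal_pair_sub x : S2 x -> antipodal_pair x `<=` S2.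
Proof. by move=> Sx y [->//|->]; exact: S2N. Qed.

Lemma S2_Rintegral_generic x (f : cV -> R) : S2_integrable f ->
  \int[mu]_(y in S2) f y = \int[mu]_(y in S2 `\` antipodal_pair x) f y.
Proof.
move=> hf; rewrite /Rintegral; congr fine.
apply: negligible_integral => //; first exact: measurable_antipodal_pair.
exact: antipodal_pair0.
Qed.

Lemma dot_generic x y : S2 x -> (S2 `\` antipodal_pair x) y -> -1 < dot x y < 1.
Proof.
move=> Sx [Sy]; have /S2E xx := Sx; have /S2E yy := Sy.
rewrite /antipodal_pair => /not_orP[/= yx yNx].
have pos (v : cV) : v != 0 -> 0 < dot v v.
  move=> v0; rewrite lt_neqAle; apply/andP; split; last first.
    by rewrite dotE sumr_ge0// => i _; rewrite -expr2 sqr_ge0.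
  apply: contra v0 => /eqP/esym; rewrite dotE => /eqP.
  rewrite psumr_eq0 => [/allP H|i _]; last by rewrite -expr2 sqr_ge0.
  apply/eqP/colP => i; rewrite mxE; have := H i (mem_index_enum i).
  by rewrite -expr2 sqrf_eq0 => /eqP.
have h1 : 0 < dot (x - y) (x - y).
  by apply: pos; rewrite subr_eq0; apply/eqP => xy; exact: yx.
have h2 : 0 < dot (x + y) (x + y).
  by apply: pos; rewrite addr_eq0; apply/eqP => xy; apply: yNx; rewrite xy opprK.
have e1 : dot (x - y) (x - y) = 2 - 2 * dot x y.
  transitivity (dot x x + dot y y - 2 * dot x y); last by rewrite xx yy.
  by rewrite !dotE3 !mxE; ring.
have e2 : dot (x + y) (x + y) = 2 + 2 * dot x y.
  transitivity (dot x x + dot y y + 2 * dot x y); last by rewrite xx yy.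
  by rewrite !dotE3 !mxE; ring.
by rewrite e1 e2 in h1 h2 *; apply/andP; split; lra.
Qed.

Lemma Psi_generic x y : S2 x -> (S2 `\` antipodal_pair x) y ->
  Psi psi x y = kern (kappa psi) (derive1 (kappa psi)) x y.
Proof.
move=> Sx [Sy] /not_orP[/= yx yNx].
have g : (x, y) \in generic_pairs.
  rewrite inE; split => //=; first by move/esym.
  by move=> xy; apply: yNx; rewrite xy opprK.
by rewrite /Psi /Psi_div /Psi_curl /continuous_extension g.
Qed.

Lemma Psi_approx : exists Q : nat -> {poly R}, forall n x y i j,
  S2 x -> (S2 `\` antipodal_pair x) y ->
  `|Psi psi x y i j - kernq (Q n) x y i j| <= n.+1%:R^-1.
Proof.
suff H (e : R) : 0 < e -> exists q, forall x y i j,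
    S2 x -> (S2 `\` antipodal_pair x) y ->
    `|Psi psi x y i j - kernq q x y i j| <= e.
  have n0 n : 0 < n.+1%:R^-1 :> R by rewrite invr_gt0.
  by have [Q HQ] := choice (fun n => H _ (n0 n)); exists Q => n x y i j; exact: HQ.
(* 8 = 2 + 6, the two coefficients of [kern_le]. *)
move=> e0; have e8 : 0 < e / 8 by rewrite divr_gt0.
have [q Hq] := Hpsi e8; exists q => x y i j Sx Sy.
have [] := Hq _ (dot_generic Sx Sy).
rewrite Psi_generic// /kernq -kern_sub => H1 H2.
rewrite (le_trans (kern_le _ _ _ _ Sx Sy.1))//= (_ : e = 2 * (e / 8) + 6 * (e / 8)).
  by rewrite lerD// ler_wpM2l.
by field.
Qed.

Lemma enorm_sqr (v : cV) : enorm v ^+ 2 = dot v v.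
Proof.
by rewrite /enorm sqr_sqrtr// dotE sumr_ge0// => i _; rewrite -expr2 sqr_ge0.
Qed.

Lemma measurable_enorm_sqr F : (forall i, measurable_fun S2 (fun y => F y i 0)) ->
  measurable_fun S2 (fun y => enorm (F y) ^+ 2).
Proof.
move=> mF; under eq_fun do rewrite enorm_sqr dotE3.
by do !apply: measurable_funD; exact: measurable_funM.
Qed.

Lemma S2_bounded_integrable (f : cV -> R) (M : R) : measurable_fun S2 f ->
  (forall y, S2 y -> `|f y| <= M) -> S2_integrable f.
Proof.
move=> mf fM; apply: measurable_bounded_integrable => //.
  exact: surface_measure_S2_finite.
exists M; split; first exact: num_real.
by move=> N MN y Sy /=; rewrite (le_trans (fM _ Sy))// ltW.
Qed.

Lemma L2_tangential_bounded F : (forall i, measurable_fun S2 (fun y => F y i 0)) ->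
  (forall x, S2 x -> dot x (F x) = 0) ->
  (forall i, exists M : R, forall x, S2 x -> `|F x i 0| <= M) ->
  L2_tangential F.
Proof.
move=> mF tF bF; split; first exact: measurable_fun_cvec_within.
  by apply: aeW => x Sx; exact: tF.
have [M0 H0] := bF 0; have [M1 H1] := bF 1; have [M2 H2] := bF 2.
have /integrableP[_] : S2_integrable (fun y => enorm (F y) ^+ 2).
  apply: (@S2_bounded_integrable _ (M0 ^+ 2 + M1 ^+ 2 + M2 ^+ 2)).
    exact: measurable_enorm_sqr.
  move=> y Sy; rewrite ger0_norm ?sqr_ge0// enorm_sqr dotE3.
  have sq (a M : R) : `|a| <= M -> a * a <= M ^+ 2.
    rewrite -[_ * _]ger0_norm ?normrM -?expr2 ?sqr_ge0// => aM.
    by rewrite lerXn2r ?nnegrE// (le_trans _ aM).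
  by rewrite !lerD// sq// ?H0 ?H1 ?H2.
by under eq_integral do rewrite /= ger0_norm ?sqr_ge0//.
Qed.

(** The sphere has finite measure, and |a| <= 1 + a^2. *)
Lemma L2_coord_integrable F j : L2_tangential F -> S2_integrable (fun y => F y j 0).
Proof.
move=> [mF _ F2].
have mj n : measurable_fun S2 (fun y => F y n 0) by exact: measurable_fun_cvecE.
have m2 := measurable_enorm_sqr mj.
have i1 : S2_integrable (fun y => 1 + enorm (F y) ^+ 2).
  apply: S2_integrableD.
    by apply: (@S2_bounded_integrable _ 1) => // y _; rewrite normr1.
  apply/integrableP; split; first exact/measurable_EFinP.
  by under eq_integral do rewrite /= ger0_norm ?sqr_ge0//.
apply: (le_integrable mS _ _ i1); first exact/measurable_EFinP.
move=> y Sy /=; rewrite lee_fin [leRHS]ger0_norm; last by rewrite addr_ge0// sqr_ge0.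
have : F y j 0 ^+ 2 <= enorm (F y) ^+ 2.
  rewrite enorm_sqr dotE (bigD1 j)//= -expr2 lerDl sumr_ge0// => i _.
  by rewrite -expr2 sqr_ge0.
rewrite -real_normK ?num_real//.
have := normr_ge0 (F y j 0); nra.
Qed.

Lemma mulmx_coord (A : 'M[R]_3) (v : cV) i :
  (A *m v) i 0 = A i 0 * v 0 0 + A i 1 * v 1 0 + A i 2 * v 2 0.
Proof. by rewrite mxE sum3. Qed.

Definition coord_norm1 F y : R := `|F y 0 0| + `|F y 1 0| + `|F y 2 0|.

Lemma integrable_coord_norm1 F : L2_tangential F -> S2_integrable (coord_norm1 F).
Proof.
move=> hF; have h j : S2_integrable (fun y => `|F y j 0|).
  by have := integrable_norm (L2_coord_integrable j hF).
by rewrite /coord_norm1; do !apply: S2_integrableD.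
Qed.

Lemma mulmx_coord_le (A : 'M[R]_3) F y i (e : R) : (forall j, `|A i j| <= e) ->
  `|(A *m F y) i 0| <= e * coord_norm1 F y.
Proof.
move=> Ae; rewrite mulmx_coord /coord_norm1 !mulrDr.
have h j : `|A i j * F y j 0| <= e * `|F y j 0| by rewrite normrM ler_wpM2r.
by rewrite (le_trans (ler_normD _ _))// lerD// (le_trans (ler_normD _ _))// lerD.
Qed.

Lemma kernq_operator F q i : L2_tangential F ->
  (forall x, S2 x -> S2_integrable (fun y => (kernq q x y *m F y) i 0)) /\
  measurable_fun S2 (fun x => \int[mu]_(y in S2) (kernq q x y *m F y) i 0).
Proof.
move=> hF.
have h j := measurable_kernq q i j (L2_coord_integrable j hF).
have E x : (fun y => (kernq q x y *m F y) i 0) =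
    (fun y => kernq q x y i 0 * F y 0 0 + kernq q x y i 1 * F y 1 0 +
              kernq q x y i 2 * F y 2 0).
  by apply/funext => y; rewrite mulmx_coord.
have I x j : S2 x -> S2_integrable (fun y => kernq q x y i j * F y j 0).
  by move=> Sx; exact: (h j).1.
split=> [x Sx|].
  by rewrite E; apply: S2_integrableD; [apply: S2_integrableD|]; exact: I.
apply: (@eq_measurable_fun _ _ _ _ _ (fun x =>
    \int[mu]_(y in S2) (kernq q x y i 0 * F y 0 0) +
    \int[mu]_(y in S2) (kernq q x y i 1 * F y 1 0) +
    \int[mu]_(y in S2) (kernq q x y i 2 * F y 2 0))).
  move=> x; rewrite inE => Sx; rewrite E RintegralD//; last 2 first.
    by apply: S2_integrableD; exact: I.
    exact: I.
  by rewrite RintegralD//; exact: I.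
by apply: measurable_funD; [apply: measurable_funD|]; exact: (h _).2.
Qed.

Section approximants.
Variable Q : nat -> {poly R}.
Hypothesis HQ : forall n x y i j, S2 x -> (S2 `\` antipodal_pair x) y ->
  `|Psi psi x y i j - kernq (Q n) x y i j| <= n.+1%:R^-1.

Lemma Psi_kernq_le F n x y i : S2 x -> (S2 `\` antipodal_pair x) y ->
  `|(Psi psi x y *m F y) i 0 - (kernq (Q n) x y *m F y) i 0| <=
  n.+1%:R^-1 * coord_norm1 F y.
Proof.
move=> Sx Ay.
have subE m (A B : 'M[R]_(3, m)) j k : A j k - B j k = (A - B) j k by rewrite !mxE.
rewrite subE -mulmxBl; apply: mulmx_coord_le => j.
by rewrite -subE; exact: HQ.
Qed.

(** Off the antipodal pair the integrand is a pointwise limit of measurable functions, and it is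
    dominated by means of [Q 0], whose error is at most 1. On the pair itself every function is
    measurable, as points are. *)
Lemma integrable_Psi F x i : L2_tangential F -> S2 x ->
  S2_integrable (fun y => (Psi psi x y *m F y) i 0).
Proof.
move=> hF Sx.
have hn := integrable_coord_norm1 hF.
have mPsiA : measurable_fun (S2 `\` antipodal_pair x) (fun y => (Psi psi x y *m F y) i 0).
  apply: (@measurable_fun_cvg _ _ _ _ (fun n y => (kernq (Q n) x y *m F y) i 0)).
    move=> n; apply: (measurable_funS mS) => //.
    by apply/measurable_EFinP; case/integrableP : ((kernq_operator (Q n) i hF).1 x Sx).
  move=> y Ay; apply/cvgrPdist_le => e e0.
  have c : (fun n => n.+1%:R^-1 * coord_norm1 F y) @ \oo --> 0 * coord_norm1 F y.
    by apply: cvgM; [exact: cvg_harmonic|exact: cvg_cst].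
  move: c; rewrite mul0r => /cvgrPdist_le/(_ e e0); apply: filterS => n.
  rewrite sub0r normrN => H; rewrite (le_trans (Psi_kernq_le F n i Sx Ay))//.
  by rewrite (le_trans _ H)// ler_norm.
have mPsi : measurable_fun S2 (fun y => (Psi psi x y *m F y) i 0).
  rewrite -(setDKU (antipodal_pair_sub Sx)).
  apply/measurable_funU => //; first exact: measurable_antipodal_pair.
  split=> //; apply/measurable_funU; [exact: measurable_cvec1|exact: measurable_cvec1|].
  by split; exact: measurable_fun_set1.
have g_int : S2_integrable (fun y => `|(kernq (Q 0) x y *m F y) i 0| + coord_norm1 F y).
  apply: S2_integrableD => //.
  by have := integrable_norm ((kernq_operator (Q 0%N) i hF).1 x Sx).
have iA : mu.-integrable (S2 `\` antipodal_pair x)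
    (EFin \o (fun y => (Psi psi x y *m F y) i 0)).
  apply: (le_integrable (mA x) _ _ (integrableS mS (mA x) _ g_int)) => //.
    exact/measurable_EFinP.
  move=> y Ay /=; rewrite lee_fin [leRHS]ger0_norm ?addr_ge0//.
  have := Psi_kernq_le F 0 i Sx Ay; rewrite invr1 mul1r => H.
  rewrite -(subrK ((kernq (Q 0) x y *m F y) i 0) (_ i 0)) addrC.
  by rewrite (le_trans (ler_normD _ _))// lerD.
apply/integrableP; split; first exact/measurable_EFinP.
rewrite (@ge0_negligible_integral _ _ _ _ _ (antipodal_pair x))//.
- by case/integrableP : iA.
- exact: measurable_antipodal_pair.
- by apply: measurableT_comp => //; exact/measurable_EFinP.
- exact: antipodal_pair0.
Qed.

Lemma Psi_operator_approx F n x i : L2_tangential F -> S2 x ->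
  `|integral_operator (Psi psi) F x i 0 -
    \int[mu]_(y in S2) (kernq (Q n) x y *m F y) i 0| <=
  n.+1%:R^-1 * \int[mu]_(y in S2) coord_norm1 F y.
Proof.
move=> hF Sx; rewrite mxE.
have iP := integrable_Psi i hF Sx; have iq := (kernq_operator (Q n) i hF).1 x Sx.
have hn := integrable_coord_norm1 hF.
rewrite -RintegralB// -RintegralZl//.
have iD : S2_integrable (fun y => (Psi psi x y *m F y) i 0 - (kernq (Q n) x y *m F y) i 0).
  exact: (integrableB mS iP iq).
rewrite (le_trans (le_normr_Rintegral mS iD))//.
have iDn : S2_integrable (fun y => `|(Psi psi x y *m F y) i 0 - (kernq (Q n) x y *m F y) i 0|).
  by have := integrable_norm iD.
have ie := S2_integrableZ n.+1%:R^-1 hn.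
rewrite (S2_Rintegral_generic x iDn) (S2_Rintegral_generic x ie).
apply: le_Rintegral => //.
- by apply: (integrableS mS (mA x) _ iDn).
- by apply: (integrableS mS (mA x) _ ie).
- by move=> y Ay; exact: Psi_kernq_le.
Qed.

Lemma Psi_operator_cvg F x i : L2_tangential F -> S2 x ->
  (fun n => \int[mu]_(y in S2) (kernq (Q n) x y *m F y) i 0) @ \oo -->
  integral_operator (Psi psi) F x i 0.
Proof.
move=> hF Sx; apply/cvgrPdist_le => e e0.
set C := \int[mu]_(y in S2) coord_norm1 F y.
have c : (fun n => n.+1%:R^-1 * C) @ \oo --> 0 * C.
  by apply: cvgM; [exact: cvg_harmonic|exact: cvg_cst].
move: c; rewrite mul0r => /cvgrPdist_le/(_ e e0); apply: filterS => n.
rewrite sub0r normrN => H; rewrite (le_trans (Psi_operator_approx n i hF Sx))//.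
by rewrite (le_trans _ H)// ler_norm.
Qed.

Lemma kernq_bounded q : exists M : R, forall x y i j, S2 x -> S2 y ->
  `|kernq q x y i j| <= M.
Proof.
have N11 : -1 <= 1 :> R by lra.
have [M1 HM1] := segment_bounded N11 (@continuous_horner R q).
have [M2 HM2] := segment_bounded N11 (@continuous_horner R q^`()).
exists (2 * M2 + 6 * M1) => x y i j Sx Sy.
have t1 := dot_le1 Sx Sy; have t11 : -1 <= dot x y <= 1 by rewrite -ler_norml.
rewrite (le_trans (kern_le _ _ _ _ Sx Sy))// lerD// ler_wpM2l ?HM1//.
rewrite (le_trans _ (HM2 _ t11))// ler_piMl// lerBlDr lerDl sqr_ge0//.
Qed.

(** On a set of finite measure, boundedness is a short way to the square integrability of the image.
    The polynomial kernel of [Q 0] is bounded by [M], and its distance 1 to Psi accounts for the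
    extra [C]. *)
Lemma Psi_operator_bounded F i : L2_tangential F -> exists M : R,
  forall x, S2 x -> `|integral_operator (Psi psi) F x i 0| <= M.
Proof.
move=> hF; have [M HM] := kernq_bounded (Q 0%N).
set C := \int[mu]_(y in S2) coord_norm1 F y.
have hn := integrable_coord_norm1 hF.
exists (M * C + C) => x Sx.
have := Psi_operator_approx 0 i hF Sx; rewrite invr1 mul1r -/C => H.
have iq := (kernq_operator (Q 0%N) i hF).1 x Sx.
have H0 : `|\int[mu]_(y in S2) (kernq (Q 0%N) x y *m F y) i 0| <= M * C.
  rewrite (le_trans (le_normr_Rintegral mS iq))// -RintegralZl//.
  apply: le_Rintegral => //.
  - by have := integrable_norm iq.
  - exact: S2_integrableZ.
  - by move=> y Sy; apply: mulmx_coord_le => j; exact: HM.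
rewrite -[X in `|X|](subrK (\int[mu]_(y in S2) (kernq (Q 0%N) x y *m F y) i 0)).
by rewrite (le_trans (ler_normD _ _))// addrC lerD.
Qed.

Lemma Psi_operator_measurable F i : L2_tangential F ->
  measurable_fun S2 (fun x => integral_operator (Psi psi) F x i 0).
Proof.
move=> hF; apply: (@measurable_fun_cvg _ _ _ _
  (fun n x => \int[mu]_(y in S2) (kernq (Q n) x y *m F y) i 0)).
  by move=> n; exact: (kernq_operator (Q n) i hF).2.
by move=> x Sx; exact: Psi_operator_cvg.
Qed.

Lemma dot_Psi_operator F x : L2_tangential F -> S2 x ->
  dot x (integral_operator (Psi psi) F x) = 0.
Proof.
move=> hF Sx; have iP i := integrable_Psi i hF Sx.
have iZ i : S2_integrable (fun y => x i 0 * (Psi psi x y *m F y) i 0).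
  exact: S2_integrableZ.
have E i : x i 0 * integral_operator (Psi psi) F x i 0 =
    \int[mu]_(y in S2) (x i 0 * (Psi psi x y *m F y) i 0).
  by rewrite mxE (RintegralZl _ mS (iP i)).
have i01 := S2_integrableD (iZ 0) (iZ 1).
rewrite dotE3 !E -(RintegralD mS (iZ 0) (iZ 1)) -(RintegralD mS i01 (iZ 2)).
rewrite (S2_Rintegral_generic x (S2_integrableD i01 (iZ 2))).
rewrite (@eq_Rintegral _ _ _ _ _ (fun=> 0)) ?Rintegral_cst ?mul0r// => y.
rewrite inE => Ay; rewrite Psi_generic// !mulmx_coord.
have T j := kern_tangential (kappa psi) (derive1 (kappa psi)) y j Sx.
have := T 0; have := T 1; have := T 2; rewrite !sum3.
set K := kern _ _ _ _ => T2 T1 T0.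
transitivity ((x 0 0 * K 0 0 + x 1 0 * K 1 0 + x 2 0 * K 2 0) * F y 0 0 +
  (x 0 0 * K 0 1 + x 1 0 * K 1 1 + x 2 0 * K 2 1) * F y 1 0 +
  (x 0 0 * K 0 2 + x 1 0 * K 1 2 + x 2 0 * K 2 2) * F y 2 0); last first.
  by rewrite T0 T1 T2 !mul0r !addr0.
move: (K 0 0) (K 0 1) (K 0 2) (K 1 0) (K 1 1) (K 1 2) (K 2 0) (K 2 1) (K 2 2).
by move: (x 0 0) (x 1 0) (x 2 0) (F y 0 0) (F y 1 0) (F y 2 0) => *; ring.
Qed.

Lemma L2_Psi_operator F : L2_tangential F ->
  L2_tangential (integral_operator (Psi psi) F).
Proof.
move=> hF; apply: L2_tangential_bounded => [i|x|i].
- exact: Psi_operator_measurable.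
- exact: dot_Psi_operator.
- exact: Psi_operator_bounded.
Qed.

Lemma linear_Psi_operator : linear_operator_L2 (integral_operator (Psi psi)).
Proof.
split.
- exact: L2_Psi_operator.
- move=> F G hF hG FG; apply: aeW => x Sx; apply/colP => i; rewrite !mxE.
  have iF := integrable_Psi i hF Sx; have iG := integrable_Psi i hG Sx.
  congr fine; apply: ae_eq_integral => //.
  + by case/integrableP : iF.
  + by case/integrableP : iG.
  by apply: filterS FG => y /= FG Sy; rewrite FG.
- move=> a F G hF hG; apply: aeW => x Sx; apply/colP => i.
  have iF := integrable_Psi i hF Sx; have iG := integrable_Psi i hG Sx.
  rewrite [LHS]mxE [RHS]mxE [X in _ = X + _]mxE [X in _ = _ * X + _]mxE [X in _ = _ + X]mxE.
  rewrite -RintegralZl// -RintegralD//; last exact: S2_integrableZ.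
  apply: eq_Rintegral => y _ /=; rewrite mulmxDr -scalemxAr [LHS]mxE; congr (_ + _).
  by rewrite mxE.
Qed.

End approximants.

End matrix_kernel.

(** * Eigenvalues of the limit operator *)

Section eigenvalues.
Context {R : realType}.
Local Notation mu := (surface_measure R).
Local Notation cV := 'cV[R]_3.
Local Notation mp := (mpoly.mpoly 3 R).
Variable psi : R -> R.
Implicit Types (x y : cV) (p : mp) (i j : 'I_3) (l : nat).

(** No convergence of the factors b is needed: the relation w_n(k) u(k0) = w_n(k0) u(k) no longer
    contains them and passes to the limit. If u is identically zero, so are all w_n and hence v. *)
Lemma proportional_limit (I : Type) (u v : I -> R) (w : nat -> I -> R) :
  (forall n, exists b, forall k, w n k = b * u k) ->
  (forall k, w n k @[n --> \oo] --> v k) ->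
  exists a, forall k, v k = a * u k.
Proof.
move=> wu wv; have [[k0 uk0]|u0] := pselect (exists k, u k != 0); last first.
  have {}u0 k : u k = 0 by apply/eqP/negPn/negP => uk; apply: u0; exists k.
  exists 0 => k; rewrite mul0r; apply: (cvg_unique _ (wv k)) => //.
  rewrite (_ : w ^~ k = cst 0); first exact: cvg_cst.
  by apply/funext => n; have [b ->] := wu n; rewrite u0 mulr0.
exists (v k0 / u k0) => k; apply: (mulIf uk0); rewrite mulrAC divfK//.
have h1 : w n k * u k0 @[n --> \oo] --> v k * u k0 by apply: cvgM => //; exact: cvg_cst.
apply: (cvg_unique _ h1) => //.
rewrite (_ : (fun n => w n k * u k0) = (fun n => w n k0 * u k)).
  by apply: cvgM => //; exact: cvg_cst.
by apply/funext => n; have [b bE] := wu n; rewrite !bE mulrAC.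
Qed.

Lemma L2_surface_curl p : L2_tangential (surface_curl (ev ^~ p)).
Proof.
apply: L2_tangential_bounded => [i|x _|i].
- under eq_fun do rewrite surface_curl_ev.
  by apply: measurable_funTS; exact: measurable_ev.
- exact: dot_surface_curl.
- have [M HM] := ev_bounded (rot_op i p).
  by exists M => x Sx; rewrite surface_curl_ev; exact: HM.
Qed.

Lemma L2_surface_grad l p : homogeneous l p -> L2_tangential (surface_grad (ev ^~ p)).
Proof.
move=> hp; apply: L2_tangential_bounded => [i|x Sx|i].
- apply: (@eq_measurable_fun _ _ _ _ _ (ev ^~ (sgrad_op l i p))) => [x|].
    by rewrite inE => Sx; rewrite (surface_grad_ev _ Sx hp).
  by apply: measurable_funTS; exact: measurable_ev.
- exact: dot_surface_grad.
- have [M HM] := ev_bounded (sgrad_op l i p).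
  by exists M => x Sx; rewrite (surface_grad_ev _ Sx hp); exact: HM.
Qed.

Variable Q : nat -> {poly R}.
Hypothesis HQ : forall n x y i j, S2 x -> (S2 `\` antipodal_pair x) y ->
  `|Psi psi x y i j - kernq (Q n) x y i j| <= n.+1%:R^-1.

Lemma Psi_eigen l : (1 <= l)%N -> exists a : R * R, forall p x, harmonic l p -> S2 x ->
  integral_operator (Psi psi) (surface_curl (ev ^~ p)) x =
    a.1 *: surface_curl (ev ^~ p) x /\
  integral_operator (Psi psi) (surface_grad (ev ^~ p)) x =
    a.2 *: surface_grad (ev ^~ p) x.
Proof.
move=> l1.
(* All harmonics of degree l, points and coordinates form one index set, so that a single factor is
   obtained for all of them. *)
pose I := {z : mp * cV * 'I_3 | harmonic l z.1.1 /\ S2 z.1.2}.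
pose fc (z : I) := surface_curl (ev ^~ (sval z).1.1) (sval z).1.2 (sval z).2 0.
pose fg (z : I) := surface_grad (ev ^~ (sval z).1.1) (sval z).1.2 (sval z).2 0.
have [a Ha] : exists a, forall z : I, integral_operator (Psi psi)
    (surface_curl (ev ^~ (sval z).1.1)) (sval z).1.2 (sval z).2 0 = a * fc z.
  apply: (proportional_limit (w := fun n z => \int[mu]_(y in S2)
      (kernq (Q n) (sval z).1.2 y *m surface_curl (ev ^~ (sval z).1.1) y) (sval z).2 0)).
    move=> n; have [b Hb] := kernq_eigen (Q n) l1; exists b => -[[[p x] i] [/= hp Sx]].
    exact: (Hb x i p Sx hp).1.
  move=> [[[p x] i] [/= hp Sx]].
  by apply: Psi_operator_cvg => //; exact: L2_surface_curl.
have [b Hb] : exists b, forall z : I, integral_operator (Psi psi)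
    (surface_grad (ev ^~ (sval z).1.1)) (sval z).1.2 (sval z).2 0 = b * fg z.
  apply: (proportional_limit (w := fun n z => \int[mu]_(y in S2)
      (kernq (Q n) (sval z).1.2 y *m surface_grad (ev ^~ (sval z).1.1) y) (sval z).2 0)).
    move=> n; have [b Hb] := kernq_eigen (Q n) l1; exists b => -[[[p x] i] [/= hp Sx]].
    exact: (Hb x i p Sx hp).2.
  move=> [[[p x] i] [/= hp Sx]].
  by apply: Psi_operator_cvg => //; exact: (L2_surface_grad hp.1).
exists (a, b) => p x hp Sx; split; apply/colP => i; rewrite [RHS]mxE.
  exact: (Ha (exist _ (p, x, i) (conj hp Sx))).
exact: (Hb (exist _ (p, x, i) (conj hp Sx))).
Qed.

Lemma integral_operatorZ (c : R) F x : L2_tangential F -> S2 x ->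
  integral_operator (Psi psi) (c \*: F) x = c *: integral_operator (Psi psi) F x.
Proof.
move=> hF Sx; apply/colP => i; rewrite [LHS]mxE [RHS]mxE [X in _ = _ * X]mxE.
rewrite -(RintegralZl _ measurable_S2 (integrable_Psi HQ i hF Sx)).
by apply: eq_Rintegral => y _ /=; rewrite -scalemxAr [LHS]mxE.
Qed.

End eigenvalues.

(** * The profile of a scaled zonal kernel *)

Section zonal_kernels.
Context {R : realType}.
Local Notation mu := (surface_measure R).
Local Notation leb := (@lebesgue_measure R).
Local Notation cV := 'cV[R]_3.

Lemma continuous_within_comp (f g : R -> R) (A : set R) :
  {within A, continuous f} -> continuous g -> (forall t, A (g t)) -> continuous (f \o g).
Proof.
move=> /subspace_continuousP cf cg gA t.
apply: (cvg_comp g f _ (cf _ (gA t))).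
move=> U; rewrite /within /= => AU.
have : nbhs t (g @^-1` [set s | A s -> U s]) := cg t _ AU.
by apply: filterS => s /= /(_ (gA s)).
Qed.

(** The values of psi are prescribed on [-1, 1] only; [p] agrees with it there and is continuous on
    the whole line, as the approximation of kappa requires. *)
Lemma zonal_profile (phi psi : R -> R) (rho : R) : 0 < rho ->
  {within `[0, +oo[, continuous phi} -> scaled_zonal_kernel phi rho psi ->
  exists p : R -> R, [/\ continuous p, forall t, -1 <= t <= 1 -> psi t = p t &
    2 * pi * \int[leb]_(t in `[-1, 1]) p t = 1].
Proof.
move=> rho0 cphi [C [psiE psi1]].
(* On the sphere |x - y|^2 = 2 - 2 t. For t > 1 the square root takes its default value 0, so that
   [g] is continuous everywhere and phi is only evaluated on [0, +oo[. *)
pose g t : R := rho^-1 * Num.sqrt (2 - 2 * t).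
pose p t : R := C * phi (g t).
have cg : continuous g.
  move=> t; apply: cvgM; first exact: cvg_cst.
  have c1 : {for t, continuous (fun t : R => 2 - 2 * t)}.
    by apply: cvgB; [exact: cvg_cst|apply: cvgM; [exact: cvg_cst|exact: cvg_id]].
  exact: (continuous_comp c1 (@sqrt_continuous R _)).
have cp : continuous p.
  move=> t; apply: cvgM; first exact: cvg_cst.
  apply: (continuous_within_comp cphi cg) => s /=.
  by rewrite in_itv/= andbT mulr_ge0 ?sqrtr_ge0// invr_ge0 ltW.
(* Against the north pole the dot product is the height. Every t in [-1, 1] is therefore attained,
   and the normalization becomes an integral in z times the length 2 pi of the theta interval. *)
pose e3 : cV := \col_(i < 3) (i == 2)%:R.
have e3E : [/\ e3 0 0 = 0, e3 1 0 = 0 & e3 2 0 = 1].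
  by rewrite !mxE !ord3E eqxx.
have [e30 e31 e32] := e3E.
have Se3 : S2 e3 by apply/S2E; rewrite dotE3 e30 e31 e32; ring.
have psip t : -1 <= t <= 1 -> psi t = p t.
  move=> /andP[t1 t2].
  pose y : cV := \col_(i < 3) nth 0 [:: Num.sqrt (1 - t ^+ 2); 0; t] i.
  have yE : [/\ y 0 0 = Num.sqrt (1 - t ^+ 2), y 1 0 = 0 & y 2 0 = t] by rewrite !mxE.
  have [y0 y1 y2] := yE.
  have sq : Num.sqrt (1 - t ^+ 2) * Num.sqrt (1 - t ^+ 2) = 1 - t ^+ 2.
    by rewrite -expr2 sqr_sqrtr//; nra.
  have Sy : S2 y by apply/S2E; rewrite dotE3 y0 y1 y2 sq; ring.
  have := psiE e3 y Se3 Sy; rewrite dotE3 e30 e31 e32 y0 y1 y2 => E.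
  have -> : t = 0 * Num.sqrt (1 - t ^+ 2) + 0 * 0 + 1 * t by ring.
  rewrite E /p /g /enorm; congr (C * phi (_ * Num.sqrt _)).
  rewrite dotE3 ![(_ - _ : cV) _ 0]mxE ![(- _ : cV) _ 0]mxE e30 e31 e32 y0 y1 y2 !sub0r mulrNN sq.
  by ring.
exists p; split=> //.
have dE x : dot x e3 = x 2 0 by rewrite dotE3 e30 e31 e32; ring.
have N11 : -1 <= 1 :> R by lra.
have [M HM] := segment_bounded N11 cp.
have := psi1 e3 Se3.
rewrite (@eq_Rintegral _ _ _ _ _ (fun x : cV => p (x 2 0))); last first.
  move=> x; rewrite inE => Sx; rewrite dE psip// -ler_norml.
  exact: S2_coord_le.
rewrite (@sphere_Rintegral_sep _ (fun x : cV => p (x 2 0)) p (cst 1) M).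
- rewrite Rintegral_cst//= lebesgue_measure_itv/= lte_fin.
  rewrite ifT ?mulr_gt0 ?pi_gt0//= => E; apply: etrans E; ring.
- apply: (measurableT_comp (continuous_measurable_fun cp)).
  exact: measurable_coord.
- by move=> x Sx; apply: HM; rewrite -ler_norml; exact: S2_coord_le.
- exact: cp.
- by move=> ?; exact: cvg_cst.
- by move=> z t _; rewrite mxE /= mulr1.
Qed.

End zonal_kernels.

Theorem proposition4p2 (R : realType)
    (Y : forall l : nat, 'I_((2 * l).+1) -> 'cV[R]_3 -> R)
    (hY : forall l : nat, harmonic_orthonormal_basis (Y l))
    (phi : R -> R) (hphi : {within `[0, +oo[, continuous phi})
    (psi : R -> R -> R)
    (hpsi : forall rho : R, 0 < rho < 1 -> scaled_zonal_kernel phi rho (psi rho))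
    (hassumption : kernel_assumption psi)
    (rho : R) (hrho : 0 < rho < 1) :
  integral_operator_defined (Psi (psi rho)) /\
  simple_fourier_legendre_multiplier Y (integral_operator (Psi (psi rho))).
Proof.
have rho0 : 0 < rho by case/andP: hrho.
have [p [cp psip intp]] := zonal_profile rho0 hphi (hpsi rho hrho).
have [Q HQ] := Psi_approx (fun e => @kappa_approx R (psi rho) p cp psip intp e).
split; first by move=> F hF x Sx i; exact: (integrable_Psi HQ).
(* The condition on l is placed under the existential so that choice yields constants for every l;
   at l = 0 they are the dummy pair (0, 0). *)
have H l : exists a : R * R, (1 <= l)%N -> forall p x, harmonic l p -> S2 x ->
    integral_operator (Psi (psi rho)) (surface_curl (ev ^~ p)) x =
      a.1 *: surface_curl (ev ^~ p) x /\
    integral_operator (Psi (psi rho)) (surface_grad (ev ^~ p)) x =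
      a.2 *: surface_grad (ev ^~ p) x.
  have [l1|] := boolP (1 <= l)%N; last by exists (0, 0).
  by have [a Ha] := Psi_eigen HQ l1; exists a.
have [a Ha] := choice H.
exists (fun l _ => (a l).1), (fun l _ => (a l).2); split=> //; split.
  exact: (linear_Psi_operator HQ).
move=> l k l1; have [/(_ k)[P [hP lP YE]] _ _] := hY l.
have hp : harmonic l P by [].
have {}YE : Y l k = ev ^~ P by [].
rewrite /y_field /z_field YE; set c := (Num.sqrt _)^-1.
split; apply: aeW => x Sx.
  rewrite (integral_operatorZ HQ c (L2_surface_curl P) Sx) (Ha l l1 P x hp Sx).1 /=.
  by rewrite !scalerA mulrC.
rewrite (integral_operatorZ HQ c (L2_surface_grad hp.1) Sx) (Ha l l1 P x hp Sx).2 /=.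
by rewrite !scalerA mulrC.
Qed.
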